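(* Let $r\in\mathbb{N}$. Each of the sequences $a(n)=\Delta^{[r]}(p)(n)$ and $a(n)=\Delta^{[r]}(\overline{p})(n)$ satisfies, for all sufficiently large $n$, $$4\left(a^2(n)-a(n-1)a(n+1)\right)\left(a^2(n+1)-a(n)a(n+2)\right)-\left(a(n)a(n+1)-a(n-1)a(n+2)\right)^2\ge0.$$
   Context: $p(n)$ is the number of partitions of $n$; $\overline{p}(n)$ is the number of overpartitions of $n$, i.e. partitions in which the first occurrence of each part may be overlined. The difference operator is $\Delta^{[1]}(a)(n):=a(n)-a(n-1)$, and for $r\ge2$, $\Delta^{[r]}(a)(n):=\Delta^{[1]}\left(\Delta^{[r-1]}(a)\right)(n)$ (considered for $n\ge r$). *)

(* Defs.v *)
From mathcomp Require Import all_boot all_order all_algebra.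

Set Implicit Arguments.
Unset Strict Implicit.
Unset Printing Implicit Defensive.

Import Order.TTheory GRing.Theory Num.Theory.

Local Open Scope nat_scope.

Definition is_partition (n : nat) (s : seq nat) : bool :=
  [&& sorted geq s, all (ltn 0) s & sumn s == n].

(* An overpartition is a list of pairs (part, overlined?): the parts form a
   partition, and an overlined part is the first occurrence of its value. *)
Definition is_overpartition (n : nat) (s : seq (nat * bool)) : bool :=
  is_partition n (unzip1 s) &&
  all (fun i => (nth (0, false) s i).2 ==>
                (index (nth 0 (unzip1 s) i) (unzip1 s) == i))
      (iota 0 (size s)).

(* A partition of n has at most n parts, each at most n, so it is enough to
   count among the bounded sequences used in p and pbar. *)
Lemma is_partition_bounded (n : nat) (s : seq nat) :
  is_partition n s -> size s <= n /\ all (fun k => k < n.+1) s.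
Proof.
case/and3P=> _ s_gt0 /eqP <-; elim: s s_gt0 => //= k s IHs /andP[k_gt0 s_gt0].
have [le_size le_parts] := IHs s_gt0; split; first by rewrite -add1n leq_add.
rewrite ltnS leq_addr /=; apply: sub_all le_parts => m /=; rewrite !ltnS => le_m.
exact: leq_trans le_m (leq_addl _ _).
Qed.

Definition p (n : nat) : nat :=
  #|[set s : n.-bseq 'I_n.+1 | is_partition n [seq val k | k <- s]]|.

Definition pbar (n : nat) : nat :=
  #|[set s : n.-bseq ('I_n.+1 * bool)%type |
      is_overpartition n [seq (val x.1, x.2) | x <- s]]|.

Local Open Scope ring_scope.

(* Truncated predecessor: the value at n = 0 is junk, and the r-th iterate is
   meaningful only for n >= r. *)
Definition diff (a : nat -> int) (n : nat) : int := a n - a n.-1.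

Definition diffn (r : nat) (a : nat -> int) : nat -> int := iter r diff a.

(* Main.v *)
(* Let P(q) be the generating function of p or of its overpartition analogue.
   Then log P(q) = sum_j (f(j)/j) q^j with f(j) >= j and f of linear average
   growth, so q^j enters log P as an independent compound Poisson contribution
   and a local limit theorem holds.  For n given, let x < 1 be the saddle point,
   sum_j f(j) x^j = n, and let kappa^2 = sum_j j f(j) x^j, of order (1-x)^-3.
   The k-th forward differences D_k at n of the tilted sequence x^m a(m), where
   a is the r-th difference, are the Fourier integrals of
   P(q) (1-q)^r (e^(-it) - 1)^k e^(-int) with q = x e^(it).  After rescaling by
   kappa the integrand is close to the Gaussian moment e^(-t^2/2) (-it)^k, so
   that, up to a common factor, kappa^(k+1) D_k is bounded below for k = 0,
   bounded away from 0 and negative for k = 2, and tends to 0 for k = 1, 3 by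
   parity.  The Turan expression is the discriminant of a binary cubic: it is
   unchanged when a(n), ..., a(n+3) are replaced by D_0, ..., D_3, up to a power
   of x, and is then dominated by -4 D_0 D_2^3 > 0. *)
From Stdlib Require Factorial Reals Lra Lia Psatz.
From Coquelicot Require Coquelicot.

(** Put h = 1 - x. Linear average growth of f gives kappa^2 = O(h^-3) and a third moment O(h^-4),
    while f(j) >= j gives kappa^2 >= 1 / (2 h^3). At th = t / kappa the cubic Taylor remainder is
    therefore of size h^(-4 + 9/2) |t|^3 = sqrt(h) |t|^3, which fixes the rate of the Gaussian
    approximation. The obstacle is large t, where the Taylor expansion says nothing. There f(j) >= j
    is used again: |P(q)| / P(x) <= exp(-gap), where gap is the real part of 1/(1-x) - 1/(1-q), and
    1 + t^2 <= C (1 + gap)^3 on the whole circle. Hence the exponential beats every power of 1 +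
    t^2, including the one lost to the factor ((1-q)/(1-x))^r. In both cases P(q) is the product
    over k of E(q^k), with E = 1/(1-q) or E = (1+q)/(1-q). If w denotes the coefficients of q E'/E,
    then f(j) is the sum of k w(j/k) over the divisors k of j, and the term k = j alone gives f(j)
    >= j. *)

Module Analysis.
Import Stdlib.Arith.Factorial Reals Lra Lia Psatz Coquelicot.Coquelicot.
Local Open Scope R_scope.

(** * Power series of radius at least one *)

Definition unit_radius (g : nat -> R) : Prop := Rbar_le 1 (CV_radius g).

Lemma unit_radius_lt g x : unit_radius g -> Rabs x < 1 ->
  Rbar_lt (Rabs x) (CV_radius g).
Proof. intros Hg Hx. now apply Rbar_lt_le_trans with 1. Qed.

Lemma unit_radius_ex g x : unit_radius g -> Rabs x < 1 -> ex_pseries g x.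
Proof. intros Hg Hx. now apply CV_radius_inside, unit_radius_lt. Qed.

Lemma unit_radius_ex_series g x : unit_radius g -> Rabs x < 1 ->
  ex_series (fun n => g n * x ^ n).
Proof. intros Hg Hx. now apply ex_pseries_R, unit_radius_ex. Qed.

Lemma unit_radius_bounded g :
  (forall x, 0 < x < 1 -> exists M, forall n, Rabs (g n * x ^ n) <= M) ->
  unit_radius g.
Proof.
intros H. unfold unit_radius.
destruct (CV_radius_bounded g) as [ub _].
destruct (CV_radius g) as [r| |] eqn:E; simpl in *; auto.
- destruct (Rle_lt_dec 1 r) as [|Hr]; auto.
  assert (Hr0 : 0 <= r).
  { pose proof (CV_radius_ge_0 g) as H0; rewrite E in H0; exact H0. }
  assert (H1 : 0 < (1 + r) / 2 < 1) by lra.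
  specialize (ub _ (H _ H1)); simpl in ub; lra.
- assert (H1 : 0 < 1 / 2 < 1) by lra.
  exact (ub _ (H _ H1)).
Qed.

Lemma unit_radius_const c : unit_radius (fun _ => c).
Proof.
apply unit_radius_bounded; intros x Hx; exists (Rabs c); intros n.
rewrite Rabs_mult, <- (Rmult_1_r (Rabs c)), Rmult_assoc, Rmult_1_l.
apply Rmult_le_compat_l; [apply Rabs_pos|].
rewrite <- RPow_abs, (Rabs_pos_eq x) by lra.
rewrite <- (pow1 n). apply pow_incr; lra.
Qed.

Lemma unit_radius_le g g' : (forall n, Rabs (g n) <= Rabs (g' n)) ->
  unit_radius g' -> unit_radius g.
Proof.
intros H Hg'. unfold unit_radius in *.
apply Rbar_le_trans with (CV_radius g'); auto.
apply (proj2 (CV_radius_bounded g')). intros x [M HM].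
apply (proj1 (CV_radius_bounded g)). exists M. intros n.
eapply Rle_trans; [|apply (HM n)]. rewrite !Rabs_mult.
apply Rmult_le_compat_r; [apply Rabs_pos|auto].
Qed.

Lemma unit_radius_scal c g : unit_radius g -> unit_radius (fun n => c * g n).
Proof.
intros Hg. destruct (Req_dec c 0) as [->|Hc].
- apply unit_radius_le with (fun _ => 0); [|apply unit_radius_const].
  intros n; rewrite Rmult_0_l; lra.
- unfold unit_radius.
  rewrite (CV_radius_ext _ (PS_scal c g)) by reflexivity.
  now rewrite CV_radius_scal.
Qed.

Lemma unit_radius_natmul g : unit_radius g -> unit_radius (fun n => INR n * g n).
Proof.
intros Hg. unfold unit_radius.
rewrite (CV_radius_ext _ (PS_incr_1 (PS_derive g))).
- now rewrite CV_radius_incr_1, CV_radius_derive.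
- intros [|n]; [apply Rmult_0_l|reflexivity].
Qed.

Lemma unit_radius_plus g g' : unit_radius g -> unit_radius g' ->
  unit_radius (fun n => g n + g' n).
Proof.
intros Hg Hg'. unfold unit_radius.
apply Rbar_le_trans with (Rbar_min (CV_radius g) (CV_radius g')).
- unfold unit_radius in *. unfold Rbar_min.
  destruct (CV_radius g), (CV_radius g'); simpl in *; auto.
  now apply Rmin_glb.
- apply CV_radius_plus.
Qed.

Lemma unit_radius_pow d : unit_radius (fun n => (INR n + 1) ^ d).
Proof.
induction d as [|d IH]; [apply unit_radius_const|].
apply unit_radius_le with
  (fun n => INR n * (INR n + 1) ^ d + (INR n + 1) ^ d).
- intros n. simpl. right. f_equal. ring.
- apply unit_radius_plus; auto. now apply unit_radius_natmul.
Qed.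

Lemma PSeries_le g g' x : 0 <= x < 1 -> unit_radius g' ->
  (forall n, 0 <= g n <= g' n) -> PSeries g x <= PSeries g' x.
Proof.
intros Hx Hg' H. unfold PSeries. apply Series_le.
- intros n. assert (0 <= x ^ n) by (apply pow_le; lra).
  specialize (H n); split; [apply Rmult_le_pos|apply Rmult_le_compat_r]; lra.
- apply unit_radius_ex_series; auto. rewrite Rabs_pos_eq; lra.
Qed.

(** Abel summation: [PS_incr_1 S] is [S] delayed by one index. Every growth estimate for a power
    series near 1 below comes from this identity. *)
Lemma PSeries_increments S x : unit_radius S -> Rabs x < 1 ->
  PSeries (fun n => S n - PS_incr_1 S n) x = (1 - x) * PSeries S x.
Proof.
intros HS Hx.
rewrite (PSeries_ext _ (PS_plus S (PS_opp (PS_incr_1 S)))) by reflexivity.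
assert (ex_pseries S x) by now apply unit_radius_ex.
rewrite PSeries_plus, PSeries_opp, PSeries_incr_1; auto.
- ring.
- apply ex_pseries_opp. now apply ex_pseries_incr_1.
Qed.

Lemma PSeries_geom x : Rabs x < 1 -> PSeries (fun _ => 1) x = / (1 - x).
Proof.
intros Hx. unfold PSeries. rewrite <- Series_geom by auto.
apply Series_ext; intros n; ring.
Qed.

Lemma pow_increment_le d y : 0 <= y ->
  (y + 1) ^ S d - y ^ S d <= INR (S d) * (y + 1) ^ d.
Proof.
intros Hy. induction d as [|d IH]; [simpl; lra|].
rewrite S_INR. replace ((y + 1) ^ S (S d) - y ^ S (S d))
  with ((y + 1) * ((y + 1) ^ S d - y ^ S d) + y ^ S d) by (simpl; ring).
assert (y ^ S d <= (y + 1) ^ S d) by (apply pow_incr; lra).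
apply Rmult_le_compat_l with (r := y + 1) in IH; [|lra].
replace ((INR (S d) + 1) * (y + 1) ^ S d) with
  ((y + 1) * (INR (S d) * (y + 1) ^ d) + (y + 1) ^ S d) by (simpl; ring).
lra.
Qed.

(** The increments of (n+1)^(d+1) are at most (d+1) (n+1)^d, so by Abel summation each further power
    costs a factor (d+1) / (1-x). *)
Lemma PSeries_pow_le d x : 0 <= x < 1 ->
  PSeries (fun n => (INR n + 1) ^ d) x <= INR (fact d) / (1 - x) ^ S d.
Proof.
intros Hx. assert (Hax : Rabs x < 1) by (rewrite Rabs_pos_eq; lra).
induction d as [|d IH].
- rewrite (PSeries_ext _ (fun _ => 1)), PSeries_geom by auto. right. simpl. field. lra.
- set (T := PSeries (fun n => (INR n + 1) ^ S d) x) in *.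
  assert (H : (1 - x) * T <= INR (S d) * (INR (fact d) / (1 - x) ^ S d)).
  { unfold T. rewrite <- PSeries_increments by (auto; apply unit_radius_pow).
    apply Rle_trans with
      (INR (S d) * PSeries (fun n => (INR n + 1) ^ d) x).
    - rewrite <- PSeries_scal. apply PSeries_le; auto.
      + apply unit_radius_scal, unit_radius_pow.
      + intros [|n].
        * change (0 <= (0 + 1) ^ S d - 0 <= INR (S d) * (0 + 1) ^ d).
          rewrite Rplus_0_l, !pow1, S_INR.
          pose proof (pos_INR d). lra.
        * change (0 <= (INR (S n) + 1) ^ S d - (INR n + 1) ^ S d
            <= INR (S d) * (INR (S n) + 1) ^ d).
          rewrite (S_INR n). pose proof (pos_INR n) as Hn.
          assert ((INR n + 1) ^ S d <= (INR n + 1 + 1) ^ S d)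
            by (apply pow_incr; lra).
          split; [lra|].
          apply (pow_increment_le d (INR n + 1)); lra.
    - apply Rmult_le_compat_l; auto. apply pos_INR. }
  assert (0 < 1 - x) by lra.
  apply Rmult_le_reg_l with (1 - x); auto.
  eapply Rle_trans; [exact H|]. right.
  rewrite fact_simpl, mult_INR. simpl. field.
  split; [apply pow_nonzero|]; lra.
Qed.

Lemma sum_f_R0_incr g n : sum_f_R0 g n - PS_incr_1 (sum_f_R0 g) n = g n.
Proof. destruct n as [|n]; simpl; [change zero with 0|]; ring. Qed.

(** A divisor sum has no linear pointwise bound, only a linear average, so the hypothesis is on
    partial sums; Abel summation turns it into a bound on the series. *)
Lemma PSeries_sums_le g d K x : 0 <= x < 1 -> (forall n, 0 <= g n) ->
  (forall n, sum_f_R0 g n <= K * (INR n + 1) ^ d) ->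
  PSeries g x <= K * INR (fact d) / (1 - x) ^ d.
Proof.
intros Hx Hg HK. assert (Hax : Rabs x < 1) by (rewrite Rabs_pos_eq; lra).
assert (HK0 : 0 <= K).
{ specialize (HK 0%nat). specialize (Hg 0%nat). simpl in HK.
  rewrite Rplus_0_l, pow1 in HK. lra. }
assert (Hb : forall n, 0 <= sum_f_R0 g n <= K * (INR n + 1) ^ d).
{ intros n; split; auto. now apply cond_pos_sum. }
assert (Hu : unit_radius (fun n => K * (INR n + 1) ^ d))
  by apply unit_radius_scal, unit_radius_pow.
assert (HS : unit_radius (sum_f_R0 g)).
{ apply unit_radius_le with (2 := Hu). intros n; rewrite !Rabs_pos_eq;
  apply Hb || (eapply Rle_trans; apply Hb). }
rewrite (PSeries_ext g (fun n => sum_f_R0 g n - PS_incr_1 (sum_f_R0 g) n))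
  by (intros n; symmetry; apply sum_f_R0_incr).
rewrite PSeries_increments; auto.
apply Rle_trans with ((1 - x) * (K * (INR (fact d) / (1 - x) ^ S d))).
- apply Rmult_le_compat_l; [lra|].
  eapply Rle_trans; [apply PSeries_le; [exact Hx|exact Hu|exact Hb]|].
  rewrite (PSeries_scal K (fun n => (INR n + 1) ^ d)).
  apply Rmult_le_compat_l; auto. now apply PSeries_pow_le.
- right. simpl. field. split; [apply pow_nonzero|]; lra.
Qed.

Lemma sum_natpow_le f m K : (forall n, 0 <= f n) ->
  (forall n, sum_f_R0 f n <= K * (INR n + 1) ^ 2) ->
  forall n, sum_f_R0 (fun j => INR j ^ m * f j) n <= K * (INR n + 1) ^ (m + 2).
Proof.
intros Hf HK n. apply Rle_trans with ((INR n + 1) ^ m * sum_f_R0 f n).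
- rewrite scal_sum. apply sum_Rle. intros j Hj. rewrite Rmult_comm.
  apply Rmult_le_compat_l; auto. apply pow_incr. apply le_INR in Hj.
  pose proof (pos_INR j). lra.
- rewrite pow_add. replace (K * ((INR n + 1) ^ m * (INR n + 1) ^ 2))
    with ((INR n + 1) ^ m * (K * (INR n + 1) ^ 2)) by ring.
  apply Rmult_le_compat_l; auto. apply pow_le. pose proof (pos_INR n). lra.
Qed.

(** * Exponential formula for the generating function *)

(* [f n / n] is the n-th Taylor coefficient of the logarithm of the generating
   function of [a]; the recurrence is its logarithmic derivative. *)
Record euler_recurrence (f a : nat -> R) (K : R) : Prop := {
  er_f0 : f 0%nat = 0;
  er_ge : forall k, INR k <= f k;
  er_sum : forall n, sum_f_R0 f n <= K * (INR n + 1) ^ 2;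
  er_a0 : a 0%nat = 1;
  er_pos : forall n, 0 <= a n;
  er_rec : forall n, INR (S n) * a (S n) =
             sum_f_R0 (fun k => f (S k) * a (n - k)%nat) n }.

Lemma sum_f_R0_le_Series g n : (forall k, 0 <= g k) -> ex_series g ->
  sum_f_R0 g n <= Series g.
Proof.
intros Hg Hex. apply sum_incr; auto.
apply is_series_Reals, Series_correct; auto.
Qed.

Lemma PSeries_term_le g x n : (forall k, 0 <= g k) -> 0 <= x < 1 ->
  unit_radius g -> sum_f_R0 (fun k => g k * x ^ k) n <= PSeries g x.
Proof.
intros Hg Hx Hu. unfold PSeries. apply sum_f_R0_le_Series.
- intros k; apply Rmult_le_pos; auto. apply pow_le; lra.
- apply unit_radius_ex_series; auto. rewrite Rabs_pos_eq; lra.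
Qed.

Lemma sum_f_R0_ge_term g n k : (forall k, 0 <= g k) -> (k <= n)%nat ->
  g k <= sum_f_R0 g n.
Proof.
intros Hg Hk. induction Hk as [|n Hk IH].
- destruct k; simpl; [lra|]. pose proof (cond_pos_sum g k Hg). lra.
- simpl. specialize (Hg (S n)). lra.
Qed.

Lemma unit_radius_mul_bounded g w : (forall n, Rabs (w n) <= 1) ->
  unit_radius g -> unit_radius (fun n => g n * w n).
Proof.
intros Hw Hg. apply unit_radius_le with (2 := Hg); intros n.
rewrite Rabs_mult. pose proof (Rabs_pos (g n)). pose proof (Hw n). nra.
Qed.

Lemma Rabs_cos_le y : Rabs (cos y) <= 1.
Proof. apply Rabs_le, COS_bound. Qed.

Lemma Rabs_sin_le y : Rabs (sin y) <= 1.
Proof. apply Rabs_le, SIN_bound. Qed.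

Definition cos_series (g : nat -> R) (x th : R) :=
  PSeries (fun n => g n * cos (INR n * th)) x.
Definition sin_series (g : nat -> R) (x th : R) :=
  PSeries (fun n => g n * sin (INR n * th)) x.

Lemma cos_radius g th : unit_radius g ->
  unit_radius (fun n => g n * cos (INR n * th)).
Proof. apply unit_radius_mul_bounded. intros; apply Rabs_cos_le. Qed.

Lemma sin_radius g th : unit_radius g ->
  unit_radius (fun n => g n * sin (INR n * th)).
Proof. apply unit_radius_mul_bounded. intros; apply Rabs_sin_le. Qed.

Lemma is_derive_unit_PSeries g x : unit_radius g -> Rabs x < 1 ->
  is_derive (PSeries g) x (PSeries (PS_derive g) x).
Proof. intros Hg Hx. now apply is_derive_PSeries, unit_radius_lt. Qed.

Section EulerRecurrence.
Variables (f a : nat -> R) (K : R).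
Hypothesis fa : euler_recurrence f a K.

Lemma er_f_pos k : 0 <= f k.
Proof. apply Rle_trans with (2 := er_ge _ _ _ fa k), pos_INR. Qed.

Lemma er_K_pos : 0 <= K.
Proof.
pose proof (er_sum _ _ _ fa 0) as H; simpl in H.
rewrite (er_f0 _ _ _ fa) in H; lra.
Qed.

Lemma er_f_radius : unit_radius f.
Proof.
apply unit_radius_le with (fun n => K * (INR n + 1) ^ 2);
  [|apply unit_radius_scal, unit_radius_pow].
intros n. rewrite !Rabs_pos_eq; [| |apply er_f_pos].
- eapply Rle_trans; [|apply (er_sum _ _ _ fa)].
  apply sum_f_R0_ge_term; auto using er_f_pos.
- apply Rmult_le_pos; [apply er_K_pos|apply pow2_ge_0].
Qed.

Lemma er_moment_radius m : unit_radius (fun j => INR j ^ m * f j).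
Proof.
induction m as [|m IH].
- apply unit_radius_le with (2 := er_f_radius). intros n; simpl.
  rewrite Rmult_1_l; lra.
- apply unit_radius_le with (fun j => INR j * (INR j ^ m * f j)).
  + intros n; simpl; right; f_equal; ring.
  + now apply unit_radius_natmul.
Qed.

Lemma er_moment_le m x : 0 <= x < 1 ->
  PSeries (fun j => INR j ^ m * f j) x
    <= K * INR (fact (m + 2)) / (1 - x) ^ (m + 2).
Proof.
intros Hx. apply PSeries_sums_le; auto.
- intros n. apply Rmult_le_pos; [apply pow_le, pos_INR|apply er_f_pos].
- apply sum_natpow_le; [apply er_f_pos|apply (er_sum _ _ _ fa)].
Qed.

(** With t(n) = a(n) x^n, the recurrence writes n t(n) as a combination of earlier terms with total
    weight at most [M0]. For n > [N] > [M0] this cannot exceed n times a common bound of the earlier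
    terms, so [M], the sum of the first terms, bounds them all. *)
Lemma er_a_radius : unit_radius a.
Proof.
apply unit_radius_bounded; intros x Hx.
set (M0 := PSeries f x). set (t n := a n * x ^ n).
assert (Ht : forall n, 0 <= t n).
{ intros n; apply Rmult_le_pos; [apply (er_pos _ _ _ fa)|apply pow_le; lra]. }
destruct (INR_unbounded M0) as [N HN].
set (M := sum_f_R0 t N).
assert (HM : 0 <= M) by now apply cond_pos_sum.
assert (Hrec : forall n, INR (S n) * t (S n) =
          sum_f_R0 (fun k => f (S k) * x ^ S k * t (n - k)%nat) n).
{ intros n. unfold t. rewrite <- Rmult_assoc, (er_rec _ _ _ fa), Rmult_comm, scal_sum.
  apply sum_eq; intros k Hk.
  replace (S n) with (S k + (n - k))%nat by lia. rewrite pow_add. ring. }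
assert (Hb : forall n, t n <= M).
{ intros n; induction n as [n IH] using (well_founded_induction Nat.lt_wf_0).
  destruct (Nat.le_gt_cases n N) as [Hn|Hn]; [now apply sum_f_R0_ge_term|].
  destruct n as [|n]; [lia|].
  assert (Hn0 : 0 < INR (S n)) by (apply lt_0_INR; lia).
  apply Rmult_le_reg_l with (INR (S n)); auto. rewrite Hrec.
  apply Rle_trans with (M * M0).
  - apply Rle_trans with (M * sum_f_R0 (fun k => f (S k) * x ^ S k) n).
    + rewrite scal_sum. apply sum_Rle; intros k Hk.
      apply Rmult_le_compat_l; [|apply IH; lia].
      apply Rmult_le_pos; [apply er_f_pos|apply pow_le; lra].
    + apply Rmult_le_compat_l; auto.
      apply Rle_trans with (2 := PSeries_term_le f x (S n) er_f_pos
        (conj (Rlt_le _ _ (proj1 Hx)) (proj2 Hx)) er_f_radius).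
      rewrite (decomp_sum _ (S n)) by lia. simpl pred.
      pose proof (er_f_pos 0). simpl pow at 2. lra.
  - rewrite Rmult_comm. apply Rmult_le_compat_r; auto.
    apply Rlt_le, Rlt_trans with (1 := HN). apply lt_INR; lia. }
exists M; intros n. rewrite Rabs_pos_eq; [apply Hb|apply Ht].
Qed.

Definition er_log k := f k / INR k.

Lemma er_log_bound k : 0 <= er_log k <= f k.
Proof.
unfold er_log. destruct k as [|k].
- rewrite (er_f0 _ _ _ fa). unfold Rdiv. rewrite Rmult_0_l. lra.
- assert (1 <= INR (S k)) by (rewrite S_INR; pose proof (pos_INR k); lra).
  pose proof (er_f_pos (S k)). split.
  + apply Rdiv_le_0_compat; lra.
  + apply Rle_div_l; [lra|]. rewrite <- (Rmult_1_r (f (S k))) at 1.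
    apply Rmult_le_compat_l; lra.
Qed.

Lemma er_natmul_log k : INR k * er_log k = f k.
Proof.
unfold er_log. destruct k as [|k].
- rewrite (er_f0 _ _ _ fa). simpl. lra.
- field. apply not_0_INR. lia.
Qed.

Lemma er_log_radius : unit_radius er_log.
Proof.
apply unit_radius_le with (2 := er_f_radius); intros n.
destruct (er_log_bound n). rewrite !Rabs_pos_eq; lra.
Qed.

(* Both sides solve the same linear differential equation in [x] along the ray
   of argument [th]. *)
Lemma er_exp_formula x th : 0 <= x < 1 ->
  cos_series a x th =
    exp (cos_series er_log x th) * cos (sin_series er_log x th) /\
  sin_series a x th =
    exp (cos_series er_log x th) * sin (sin_series er_log x th).
Proof.
intros Hx.
set (u := fun n => a n * cos (INR n * th)).
set (v := fun n => a n * sin (INR n * th)).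
set (p := fun n => er_log n * cos (INR n * th)).
set (q := fun n => er_log n * sin (INR n * th)).
assert (Hu : unit_radius u) by apply cos_radius, er_a_radius.
assert (Hv : unit_radius v) by apply sin_radius, er_a_radius.
assert (Hp : unit_radius p) by apply cos_radius, er_log_radius.
assert (Hq : unit_radius q) by apply sin_radius, er_log_radius.
assert (Hdp : unit_radius (PS_derive p)) by (unfold unit_radius; now rewrite CV_radius_derive).
assert (Hdq : unit_radius (PS_derive q)) by (unfold unit_radius; now rewrite CV_radius_derive).
assert (Hpk : forall k, PS_derive p k = f (S k) * cos (INR (S k) * th)).
{ intros k. unfold PS_derive, p. rewrite <- Rmult_assoc, er_natmul_log; auto. }
assert (Hqk : forall k, PS_derive q k = f (S k) * sin (INR (S k) * th)).
{ intros k. unfold PS_derive, q. rewrite <- Rmult_assoc, er_natmul_log; auto. }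
assert (Hang : forall n k, (k <= n)%nat ->
  INR (S n) * th = INR (S k) * th + INR (n - k) * th).
{ intros n k Hk. rewrite <- Rmult_plus_distr_r, <- plus_INR. f_equal. f_equal. lia. }
assert (Hdu : forall n, PS_derive u n =
  PS_minus (PS_mult (PS_derive p) u) (PS_mult (PS_derive q) v) n).
{ intros n. unfold PS_derive at 1, u at 1. rewrite <- Rmult_assoc, (er_rec _ _ _ fa).
  unfold PS_minus, PS_plus, PS_opp, PS_mult.
  change opp with Ropp. change plus with Rplus.
  rewrite Rmult_comm, scal_sum. fold (Rminus
   (sum_f_R0 (fun k => PS_derive p k * u (n - k)%nat) n)
   (sum_f_R0 (fun k => PS_derive q k * v (n - k)%nat) n)).
  rewrite <- minus_sum. apply sum_eq; intros k Hk.
  rewrite (Hang n k Hk), cos_plus, Hpk, Hqk. unfold u, v. ring. }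
assert (Hdv : forall n, PS_derive v n =
  PS_plus (PS_mult (PS_derive p) v) (PS_mult (PS_derive q) u) n).
{ intros n. unfold PS_derive at 1, v at 1. rewrite <- Rmult_assoc, (er_rec _ _ _ fa).
  unfold PS_plus, PS_mult. change plus with Rplus.
  rewrite Rmult_comm, scal_sum. rewrite <- plus_sum. apply sum_eq; intros k Hk.
  rewrite (Hang n k Hk), sin_plus, Hpk, Hqk. unfold u, v. ring. }
assert (Du : forall r, Rabs r < 1 -> is_derive (PSeries u) r
  (PSeries (PS_derive p) r * PSeries u r - PSeries (PS_derive q) r * PSeries v r)).
{ intros r Hr. replace (_ - _) with (PSeries (PS_derive u) r).
  - now apply is_derive_unit_PSeries.
  - rewrite (PSeries_ext _ _ r Hdu), PSeries_minus, !PSeries_mult;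
    auto using unit_radius_lt; apply ex_pseries_mult; auto using unit_radius_lt. }
assert (Dv : forall r, Rabs r < 1 -> is_derive (PSeries v) r
  (PSeries (PS_derive p) r * PSeries v r + PSeries (PS_derive q) r * PSeries u r)).
{ intros r Hr. replace (_ + _) with (PSeries (PS_derive v) r).
  - now apply is_derive_unit_PSeries.
  - rewrite (PSeries_ext _ _ r Hdv), PSeries_plus, !PSeries_mult;
    auto using unit_radius_lt; apply ex_pseries_mult; auto using unit_radius_lt. }
assert (H0 : PSeries u 0 = 1 /\ PSeries v 0 = 0 /\ PSeries p 0 = 0 /\ PSeries q 0 = 0).
{ rewrite !PSeries_0. unfold u, v, p, q. simpl INR. rewrite Rmult_0_l, cos_0, sin_0.
  rewrite (er_a0 _ _ _ fa). unfold er_log. rewrite (er_f0 _ _ _ fa). unfold Rdiv.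
  repeat split; ring. }
destruct H0 as (Hu0 & Hv0 & Hp0 & Hq0).
(* [E1] and [E2] are the real and imaginary parts of P(q) exp(-log P(q)) along the ray; their
   derivatives vanish, and at 0 they equal 1 and 0. *)
set (E1 r := exp (- PSeries p r) *
  (PSeries u r * cos (PSeries q r) + PSeries v r * sin (PSeries q r))).
set (E2 r := exp (- PSeries p r) *
  (PSeries v r * cos (PSeries q r) - PSeries u r * sin (PSeries q r))).
assert (Hcst : E1 x = 1 /\ E2 x = 0).
{ destruct (Req_dec x 0) as [->|Hx0].
  { unfold E1, E2. rewrite Hu0, Hv0, Hp0, Hq0, Ropp_0, exp_0, cos_0, sin_0.
    split; ring. }
  assert (H1 : E1 0 = E1 x).
  { apply eq_is_derive; [|lra]. intros r Hr.
    assert (Hr1 : Rabs r < 1) by (rewrite Rabs_pos_eq; lra).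
    pose proof (Du r Hr1) as H1. pose proof (Dv r Hr1) as H2.
    pose proof (is_derive_unit_PSeries p r Hp Hr1) as H3.
    pose proof (is_derive_unit_PSeries q r Hq Hr1) as H4.
    unfold E1. auto_derive.
    - repeat split; eexists; eassumption.
    - rewrite (is_derive_unique (fun y : R => PSeries u y) _ _ H1),
        (is_derive_unique (fun y : R => PSeries v y) _ _ H2),
        (is_derive_unique (fun y : R => PSeries p y) _ _ H3),
        (is_derive_unique (fun y : R => PSeries q y) _ _ H4).
      change zero with 0. ring. }
  assert (H2 : E2 0 = E2 x).
  { apply eq_is_derive; [|lra]. intros r Hr.
    assert (Hr1 : Rabs r < 1) by (rewrite Rabs_pos_eq; lra).
    pose proof (Du r Hr1) as H2. pose proof (Dv r Hr1) as H3.
    pose proof (is_derive_unit_PSeries p r Hp Hr1) as H4.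
    pose proof (is_derive_unit_PSeries q r Hq Hr1) as H5.
    unfold E2. auto_derive.
    - repeat split; eexists; eassumption.
    - rewrite (is_derive_unique (fun y : R => PSeries u y) _ _ H2),
        (is_derive_unique (fun y : R => PSeries v y) _ _ H3),
        (is_derive_unique (fun y : R => PSeries p y) _ _ H4),
        (is_derive_unique (fun y : R => PSeries q y) _ _ H5).
      change zero with 0. ring. }
  rewrite <- H1, <- H2. unfold E1, E2.
  rewrite Hu0, Hv0, Hp0, Hq0, Ropp_0, exp_0, cos_0, sin_0. split; ring. }
unfold cos_series, sin_series. fold u v p q.
destruct Hcst as [H1 H2]. unfold E1 in H1. unfold E2 in H2.
rewrite exp_Ropp in H1, H2. pose proof (exp_pos (PSeries p x)) as He.
pose proof (sin2_cos2 (PSeries q x)) as Hsc. unfold Rsqr in Hsc.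
set (e := exp (PSeries p x)) in *. set (c := cos (PSeries q x)) in *.
set (s := sin (PSeries q x)) in *. set (U := PSeries u x) in *.
set (V := PSeries v x) in *.
assert (H1' : U * c + V * s = e) by (apply (f_equal (Rmult e)) in H1; field_simplify in H1; lra).
assert (H2' : V * c - U * s = 0) by (apply (f_equal (Rmult e)) in H2; field_simplify in H2; lra).
split.
- transitivity (U * (s * s + c * c)); [rewrite Hsc; ring|].
  transitivity (c * (U * c + V * s) - s * (V * c - U * s)); [ring|].
  rewrite H1', H2'; ring.
- transitivity (V * (s * s + c * c)); [rewrite Hsc; ring|].
  transitivity (s * (U * c + V * s) + c * (V * c - U * s)); [ring|].
  rewrite H1', H2'; ring.
Qed.

End EulerRecurrence.

(** * Fourier coefficients *)

Lemma Series_abs_le (w t : nat -> R) : (forall k, Rabs (w k) <= t k) ->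
  ex_series t -> Rabs (Series w) <= Series t.
Proof.
intros Hw Ht.
assert (Hwa : ex_series (fun k => Rabs (w k))).
{ apply (@ex_series_le R_AbsRing R_CompleteNormedModule _ t); auto. intros n.
  unfold norm; simpl; unfold abs; simpl. rewrite Rabs_Rabsolu; auto. }
apply Rle_trans with (Series (fun k => Rabs (w k))).
- now apply Series_Rabs.
- apply Series_le; auto. intros n; split; [apply Rabs_pos|apply Hw].
Qed.

Lemma Series_tail_le w t N : (forall k, Rabs (w k) <= t k) -> ex_series t ->
  Rabs (Series w - sum_f_R0 w N) <= Series t - sum_f_R0 t N.
Proof.
intros Hw Ht.
assert (Hwe : ex_series w).
{ apply (@ex_series_le R_AbsRing R_CompleteNormedModule _ t); auto. }
rewrite (Series_incr_n w (S N)), (Series_incr_n t (S N)) by (auto; lia).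
simpl pred.
replace (_ + _ - _) with (Series (fun k => w (S N + k)%nat)) by ring.
replace (_ + _ - _) with (Series (fun k => t (S N + k)%nat)) by ring.
apply Series_abs_le; auto. now apply ex_series_incr_n.
Qed.

Lemma is_RInt_cos_period (m : R) : m <> 0 -> sin (m * PI) = 0 ->
  is_RInt (fun th => cos (m * th)) (- PI) PI 0.
Proof.
intros Hm Hs.
replace 0 with (minus (sin (m * PI) / m) (sin (m * - PI) / m)).
- apply (is_RInt_derive (fun th => sin (m * th) / m)).
  + intros y _. auto_derive; auto. field; auto.
  + intros y _. apply (ex_derive_continuous (fun th => cos (m * th))).
    auto_derive; auto.
- replace (m * - PI) with (- (m * PI)) by ring.
  rewrite sin_neg, Hs. change (0 / m - (- 0) / m = 0). field; auto.
Qed.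

Lemma sin_nat_PI n : sin (INR n * PI) = 0.
Proof.
induction n as [|n IH]; [simpl; rewrite Rmult_0_l; apply sin_0|].
rewrite S_INR, Rmult_plus_distr_r, Rmult_1_l, neg_sin, IH; ring.
Qed.

Lemma is_RInt_cos_diff k n :
  is_RInt (fun th => cos ((INR k - INR n) * th)) (- PI) PI
    (if Nat.eqb k n then 2 * PI else 0).
Proof.
destruct (Nat.eqb_spec k n) as [->|Hkn].
- apply (is_RInt_ext (fun _ => 1)).
  { intros y _. rewrite Rminus_diag, Rmult_0_l, cos_0; auto. }
  replace (2 * PI) with ((PI - - PI) * 1) by ring.
  apply (is_RInt_const (V := R_NormedModule) (- PI) PI 1).
- apply is_RInt_cos_period.
  + intros H. apply Hkn, INR_eq. lra.
  + replace ((INR k - INR n) * PI) with (INR k * PI - INR n * PI) by ring.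
    rewrite sin_minus, !sin_nat_PI; ring.
Qed.

Lemma fourier_coefficient t n : (forall k, 0 <= t k) -> ex_series t ->
  is_RInt (fun th => Series (fun k => t k * cos ((INR k - INR n) * th)))
    (- PI) PI (2 * PI * t n).
Proof.
intros Ht He.
set (F := fun (N : nat) (th : R) =>
  sum_f_R0 (fun k => t k * cos ((INR k - INR n) * th)) N).
set (h := fun N => sum_f_R0 (fun k => t k * (if Nat.eqb k n then 2 * PI else 0)) N).
set (g := fun th => Series (fun k => t k * cos ((INR k - INR n) * th))).
assert (HF : forall N, is_RInt (F N) (- PI) PI (h N)).
{ intros N. unfold F, h. induction N as [|N IH].
  - apply (is_RInt_scal (fun th => cos ((INR 0 - INR n) * th))), is_RInt_cos_diff.
  - apply (is_RInt_plus (fun th => sum_f_R0 _ N)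
      (fun th => t (S N) * cos ((INR (S N) - INR n) * th))); auto.
    apply (is_RInt_scal (fun th => cos ((INR (S N) - INR n) * th))),
      is_RInt_cos_diff. }
(* This neighbourhood is in the space of functions, so the limit is uniform in [th] (Weierstrass
   test) and passes through the integral. The integrals [h N] are constant from N = n on. *)
assert (Hlim : filterlim F eventually (locally (g : R -> R))).
{ intros P [eps HP]. pose proof (Series_correct t He) as Hc.
  unfold is_series in Hc.
  destruct (proj1 (filterlim_locally _ _) Hc eps) as [N0 HN0].
  exists N0. intros N HN. apply HP. intros th. specialize (HN0 N HN).
  change (Rabs (F N th - g th) < eps).
  change (Rabs (sum_n t N - Series t) < eps) in HN0.
  rewrite sum_n_Reals in HN0.
  assert (Hb := Series_tail_le (fun k => t k * cos ((INR k - INR n) * th)) t N).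
  rewrite Rabs_minus_sym. eapply Rle_lt_trans; [apply Hb; auto|].
  - intros k. rewrite Rabs_mult, (Rabs_pos_eq (t k)) by auto.
    pose proof (Rabs_cos_le ((INR k - INR n) * th)). specialize (Ht k). nra.
  - apply Rabs_def2 in HN0. lra. }
destruct (filterlim_RInt F (- PI) PI eventually _ g h HF Hlim) as (I & HI & HgI).
replace (2 * PI * t n) with I; auto.
refine (filterlim_locally_unique (F := eventually) h _ _ HI _).
intros P HP. exists n. intros N HN.
replace (h N) with (2 * PI * t n); [now apply locally_singleton|].
unfold h. induction HN as [|N HN IH].
- destruct n as [|n]; [simpl; ring|]. rewrite tech5, Nat.eqb_refl.
  rewrite (sum_eq _ (fun _ => 0)).
  + rewrite sum_cte. ring.
  + intros i Hi. destruct (Nat.eqb_spec i (S n)); [lia|ring].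
- rewrite tech5, <- IH. destruct (Nat.eqb_spec (S N) n); [lia|ring].
Qed.

Definition cis (y : R) : C := (cos y, sin y).

Lemma cis_plus y z : cis (y + z) = (cis y * cis z)%C.
Proof.
unfold cis, Cmult; simpl. rewrite cos_plus, sin_plus. f_equal; ring.
Qed.

(** The algebra on the integrand is complex, but only real integrals are taken, the sequence being
    real. The threshold [n0] leaves out the junk values of truncated differences. *)
Definition fourier_seq (g : R -> C) (u : nat -> R) (n0 : nat) : Prop :=
  forall n, (n0 <= n)%nat ->
  is_RInt (fun th => Re (g th * cis (- (INR n * th)))%C) (- PI) PI (2 * PI * u n).

Lemma fourier_seq_shift g u n0 : fourier_seq g u n0 ->
  fourier_seq (fun th => g th * (cis (- th) - 1))%C (fun n => u (S n) - u n) n0.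
Proof.
intros H n Hn.
replace (2 * PI * (u (S n) - u n)) with (minus (2 * PI * u (S n)) (2 * PI * u n))
  by (change (2 * PI * u (S n) - 2 * PI * u n = 2 * PI * (u (S n) - u n)); ring).
eapply is_RInt_ext; [|apply (is_RInt_minus (V := R_NormedModule) _ _ _ _ _ _ (H (S n) (le_S _ _ Hn)) (H n Hn))].
intros th _.
assert (E : cis (- (INR (S n) * th)) = (cis (- th) * cis (- (INR n * th)))%C)
  by (rewrite <- cis_plus; f_equal; rewrite S_INR; ring).
cbv beta. rewrite E. unfold cis. simpl. change minus with Rminus. ring.
Qed.

(** The relation between [u] and [v] is a backward difference seen through the tilt: if u(n) = b(n)
    x^n, then v(n+1) = (b(n+1) - b(n)) x^(n+1). The threshold rises by one since v(0) is
    arbitrary. *)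
Lemma fourier_seq_diff g u v x n0 : fourier_seq g u n0 ->
  (forall n, v (S n) = u (S n) - x * u n) ->
  fourier_seq (fun th => g th * (1 - x * cis th))%C v (S n0).
Proof.
intros H Hv [|n] Hn; [lia|]. apply le_S_n in Hn.
rewrite Hv.
replace (2 * PI * (u (S n) - x * u n))
  with (minus (2 * PI * u (S n)) (scal x (2 * PI * u n)))
  by (change (2 * PI * u (S n) - x * (2 * PI * u n) = 2 * PI * (u (S n) - x * u n)); ring).
eapply is_RInt_ext; [|apply (is_RInt_minus (V := R_NormedModule) _ _ _ _ _ _ (H (S n) (le_S _ _ Hn)) (is_RInt_scal _ _ _ x _ (H n Hn)))].
intros th _. change (scal x) with (Rmult x).
assert (E : cis (- (INR n * th)) = (cis th * cis (- (INR (S n) * th)))%C)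
  by (rewrite <- cis_plus; f_equal; rewrite S_INR; ring).
cbv beta. rewrite E. unfold cis. simpl. change minus with Rminus. ring.
Qed.

Definition gen_fun (a : nat -> R) (x th : R) : C :=
  (cos_series a x th, sin_series a x th).

Lemma fourier_seq_gen_fun a x : (forall n, 0 <= a n) -> unit_radius a ->
  0 <= x < 1 -> fourier_seq (gen_fun a x) (fun n => a n * x ^ n) 0.
Proof.
intros Ha Hu Hx n _. assert (Hax : Rabs x < 1) by (rewrite Rabs_pos_eq; lra).
eapply is_RInt_ext; [|apply (fourier_coefficient (fun k => a k * x ^ k))].
- intros th _. simpl. unfold cos_series, sin_series, PSeries, cis. simpl.
  rewrite cos_neg, sin_neg.
  replace (_ - _) with
   (Series (fun k => a k * cos (INR k * th) * x ^ k) * cos (INR n * th) +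
    Series (fun k => a k * sin (INR k * th) * x ^ k) * sin (INR n * th)) by ring.
  rewrite <- !Series_scal_r, <- Series_plus.
  + apply Series_ext; intros k.
    replace ((INR k - INR n) * th) with (INR k * th - INR n * th) by ring.
    rewrite cos_minus. ring.
  + apply ex_series_scal_r. apply unit_radius_ex_series, Hax. now apply cos_radius.
  + apply ex_series_scal_r. apply unit_radius_ex_series, Hax. now apply sin_radius.
- intros k. apply Rmult_le_pos; auto. apply pow_le; lra.
- now apply unit_radius_ex_series.
Qed.

(** * Elementary inequalities *)

(** Two ladders of Taylor bounds are climbed with this, each bound being the derivative of the next:
    one starts from 1 - cos >= 0, the other from 1 - sin >= 0. *)
Lemma nonneg_of_derive (g g' : R -> R) : (forall y, is_derive g y (g' y)) ->
  g 0 = 0 -> (forall y, 0 <= y -> 0 <= g' y) -> forall y, 0 <= y -> 0 <= g y.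
Proof.
intros Hd H0 Hg' y Hy.
destruct (MVT_gen g 0 y g') as (c & Hc & E).
- intros z _; apply Hd.
- intros z _. apply continuity_pt_filterlim.
  apply (ex_derive_continuous g). eexists; apply Hd.
- rewrite Rmin_left, Rmax_right in Hc by lra. rewrite H0 in E.
  assert (0 <= g' c) by (apply Hg'; lra).
  replace (g y) with (g' c * (y - 0)) by lra. apply Rmult_le_pos; lra.
Qed.

Lemma sin_le_id y : 0 <= y -> 0 <= y - sin y.
Proof.
apply (nonneg_of_derive (fun y => y - sin y) (fun y => 1 - cos y)).
- intros z. auto_derive; auto; ring.
- rewrite sin_0; ring.
- intros z _. pose proof (COS_bound z); lra.
Qed.

Lemma cos_ge_quadratic y : 0 <= y -> 0 <= cos y - 1 + y ^ 2 / 2.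
Proof.
apply (nonneg_of_derive (fun y => cos y - 1 + y ^ 2 / 2) (fun y => y - sin y)).
- intros z. auto_derive; auto; field.
- rewrite cos_0; field.
- apply sin_le_id.
Qed.

Lemma sin_ge_cubic y : 0 <= y -> 0 <= sin y - y + y ^ 3 / 6.
Proof.
apply (nonneg_of_derive (fun y => sin y - y + y ^ 3 / 6)
  (fun y => cos y - 1 + y ^ 2 / 2)).
- intros z. auto_derive; auto; field.
- rewrite sin_0; field.
- apply cos_ge_quadratic.
Qed.

Lemma cos_ge_linear y : 0 <= y -> 0 <= y - 1 + cos y.
Proof.
apply (nonneg_of_derive (fun y => y - 1 + cos y) (fun y => 1 - sin y)).
- intros z. auto_derive; auto; ring.
- rewrite cos_0; ring.
- intros z _. pose proof (SIN_bound z); lra.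
Qed.

Lemma sin_ge_quadratic y : 0 <= y -> 0 <= y ^ 2 / 2 - y + sin y.
Proof.
apply (nonneg_of_derive (fun y => y ^ 2 / 2 - y + sin y) (fun y => y - 1 + cos y)).
- intros z. auto_derive; auto; field.
- rewrite sin_0; field.
- apply cos_ge_linear.
Qed.

Lemma cos_le_cubic y : 0 <= y -> 0 <= y ^ 3 / 6 - (cos y - 1 + y ^ 2 / 2).
Proof.
apply (nonneg_of_derive (fun y => y ^ 3 / 6 - (cos y - 1 + y ^ 2 / 2))
  (fun y => y ^ 2 / 2 - y + sin y)).
- intros z. auto_derive; auto; field.
- rewrite cos_0; field.
- apply sin_ge_quadratic.
Qed.

Lemma cos_Rabs y : cos (Rabs y) = cos y.
Proof. unfold Rabs; destruct (Rcase_abs y); [apply cos_neg|auto]. Qed.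

Lemma Rabs_sin_sub y : Rabs (sin y - y) = Rabs (sin (Rabs y) - Rabs y).
Proof.
destruct (Rle_lt_dec 0 y); [now rewrite (Rabs_pos_eq y)|].
rewrite (Rabs_left y), sin_neg, <- Rabs_Ropp by auto. f_equal; ring.
Qed.

Lemma cos_taylor y : Rabs (cos y - 1 + y ^ 2 / 2) <= Rabs y ^ 3 / 6.
Proof.
rewrite <- cos_Rabs, <- (pow2_abs y).
pose proof (Rabs_pos y) as H. apply Rabs_le.
pose proof (cos_ge_quadratic _ H). pose proof (cos_le_cubic _ H). lra.
Qed.

Lemma sin_taylor y : Rabs (sin y - y) <= Rabs y ^ 3 / 6.
Proof.
rewrite Rabs_sin_sub. pose proof (Rabs_pos y) as H. apply Rabs_le.
pose proof (sin_ge_cubic _ H). pose proof (sin_le_id _ H). lra.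
Qed.

Lemma sin_taylor2 y : Rabs (sin y - y) <= y ^ 2 / 2.
Proof.
rewrite Rabs_sin_sub, <- (pow2_abs y). pose proof (Rabs_pos y) as H. apply Rabs_le.
pose proof (sin_ge_quadratic _ H). pose proof (sin_le_id _ H). lra.
Qed.

Lemma cos_le_one_sub y : 1 - cos y <= y ^ 2 / 2.
Proof.
rewrite <- cos_Rabs, <- (pow2_abs y).
pose proof (cos_ge_quadratic _ (Rabs_pos y)). lra.
Qed.

(** Here 1 - cos y = 2 sin(y/2)^2, and the cubic bound gives sin z >= 0.57 z for 0 <= z <= 8/5, with
    2 * 0.57^2 / 4 > 1/7. *)
Lemma one_sub_cos_ge y : Rabs y <= PI -> y ^ 2 / 7 <= 1 - cos y.
Proof.
rewrite <- cos_Rabs, <- (pow2_abs y). pose proof (Rabs_pos y) as H.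
generalize dependent (Rabs y); clear y; intros y Hy HPI.
replace y with (2 * (y / 2)) at 2 by field. rewrite cos_2a_sin.
pose proof PI_4 as H4. assert (H2 : 0 <= y / 2) by lra.
(* An upper bound on PI sharper than 4 is needed. If PI/2 > 8/5 then cos(8/5) > 0, but cos(8/5) = 1
   - 2 sin(4/5)^2 and sin(4/5) >= 268/375 make it negative. *)
assert (Hpi : y / 2 <= 8 / 5).
{ apply Rle_trans with (PI / 2); [lra|].
  destruct (Rle_lt_dec (PI / 2) (8 / 5)) as [|HH]; auto.
  assert (Hc : 0 < cos (8 / 5)) by (apply cos_gt_0; lra).
  assert (Hq : 0 <= (8/5) ^ 2 / 2) by lra.
  pose proof (cos_2a (4/5)) as E2. replace (2 * (4/5)) with (8/5) in E2 by field.
  pose proof (sin2_cos2 (4/5)) as E3. unfold Rsqr in E3.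
  pose proof (sin_ge_cubic (4/5) ltac:(lra)) as E4.
  assert (268/375 <= sin (4/5)) by lra.
  assert (268/375 * (268/375) <= sin (4/5) * sin (4/5)) by (apply Rmult_le_compat; lra).
  lra. }
pose proof (sin_ge_cubic _ H2) as H3.
set (z := y / 2) in *. replace y with (2 * z) by (unfold z; field).
assert (Hs : z * (57 / 100) <= sin z).
{ apply Rle_trans with (z - z ^ 3 / 6); [|lra].
  replace (z - z ^ 3 / 6) with (z * (1 - z ^ 2 / 6)) by field.
  apply Rmult_le_compat_l; auto. nra. }
assert (z * (57/100) * (z * (57/100)) <= sin z * sin z)
  by (apply Rmult_le_compat; nra).
nra.
Qed.

Lemma exp_pow_INR n y : exp y ^ n = exp (INR n * y).
Proof.
induction n as [|n IH]; [simpl; rewrite Rmult_0_l, exp_0; auto|].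
rewrite S_INR, Rmult_plus_distr_r, Rmult_1_l, exp_plus, <- IH. simpl; ring.
Qed.

(** From exp(G/(3m)) >= (1+G)/(3m), the cube gives L (3m)^3 exp(G/m) >= L (1+G)^3 >= T, and the m-th
    power gives the claim. *)
Lemma exp_decay m L T G : (1 <= m)%nat -> 0 <= G -> 0 < T -> 0 < L ->
  T <= L * (1 + G) ^ 3 ->
  exp (- G) <= (L * (3 * INR m) ^ 3) ^ m / T ^ m.
Proof.
intros Hm HG HT HL H.
assert (Hm1 : 1 <= INR m) by (apply le_INR in Hm; exact Hm).
rewrite exp_Ropp. apply Rle_div_r; [apply pow_lt; auto|].
apply (Rmult_le_reg_l (exp G)); [apply exp_pos|].
rewrite <- Rmult_assoc, Rinv_r, Rmult_1_l by (pose proof (exp_pos G); lra).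
replace G with (INR (m + (m + m)) * (G / (3 * INR m)))
  by (rewrite !plus_INR; field; lra).
rewrite <- exp_pow_INR, !pow_add, <- !Rpow_mult_distr.
apply pow_incr. split; [lra|].
eapply Rle_trans; [exact H|].
assert (He : (1 + G) / (3 * INR m) <= exp (G / (3 * INR m))).
{ eapply Rle_trans; [|apply exp_ineq1_le].
  apply Rle_div_l; [lra|]. field_simplify; lra. }
set (E := exp _) in *.
assert (H0 : 0 <= (1 + G) / (3 * INR m)) by (apply Rdiv_le_0_compat; lra).
assert (H3 : ((1 + G) / (3 * INR m)) ^ 3 <= E ^ 3) by (apply pow_incr; auto).
replace (L * (1 + G) ^ 3) with
  (((1 + G) / (3 * INR m)) ^ 3 * (L * (3 * INR m) ^ 3)) by (field; lra).
replace (E * (E * E)) with (E ^ 3) by ring.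
apply Rmult_le_compat_r; auto.
apply Rmult_le_pos; [lra|apply pow_le; lra].
Qed.

Lemma exp_sub_le b c Q : exp b <= Q -> exp c <= Q ->
  Rabs (exp b - exp c) <= Rabs (b - c) * Q.
Proof.
assert (H : forall b c, c <= b -> exp b <= Q ->
  0 <= exp b - exp c <= (b - c) * Q).
{ clear. intros b c Hbc Hb. pose proof (exp_pos c). pose proof (exp_pos b).
  assert (Hle : exp c <= exp b).
  { destruct Hbc as [Hlt| ->]; [|lra]. left; now apply exp_increasing. }
  split; [lra|]. apply Rle_trans with ((b - c) * exp b).
  - replace c with (b + (c - b)) at 1 by ring. rewrite exp_plus.
    pose proof (exp_ineq1_le (c - b)). nra.
  - apply Rmult_le_compat_l; lra. }
intros Hb Hc. destruct (Rle_lt_dec c b) as [Hbc|Hbc].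
- specialize (H b c Hbc Hb). rewrite !Rabs_pos_eq; lra.
- specialize (H c b (Rlt_le _ _ Hbc) Hc).
  rewrite <- (Rabs_Ropp (_ - _)), <- (Rabs_Ropp (b - c)).
  rewrite !Rabs_pos_eq; lra.
Qed.

Lemma Cmod_le_Rabs (z : C) : Cmod z <= Rabs (fst z) + Rabs (snd z).
Proof.
destruct z as [u v]; simpl.
replace (u, v) with (RtoC u + RtoC v * Ci)%C.
- eapply Rle_trans; [apply Cmod_triangle|].
  rewrite Cmod_mult, Cmod_Ci, !Cmod_R; lra.
- unfold RtoC, Ci, Cplus, Cmult; simpl. f_equal; ring.
Qed.

Lemma Cmod_cis y : Cmod (cis y) = 1.
Proof.
unfold cis, Cmod; simpl. transitivity (sqrt 1); [f_equal|apply sqrt_1].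
pose proof (sin2_cos2 y) as H; unfold Rsqr in H. lra.
Qed.

Lemma Cmod_cis_sub_1 y : Cmod (cis y - 1) <= Rabs y.
Proof.
rewrite <- (sqrt_Rsqr_abs y). unfold Cmod. apply sqrt_le_1_alt.
unfold cis, Rsqr; simpl. pose proof (sin2_cos2 y) as H; unfold Rsqr in H.
pose proof (cos_le_one_sub y). nra.
Qed.

Lemma Cmod_cis_linear y : Cmod (cis (- y) - 1 + Ci * y) <= y ^ 2.
Proof.
eapply Rle_trans; [apply Cmod_le_Rabs|].
unfold cis; simpl. rewrite cos_neg, sin_neg.
pose proof (cos_le_one_sub y). pose proof (sin_taylor2 y) as Hs.
pose proof (COS_bound y).
replace (cos y + _ + _) with (- (1 - cos y)) by ring.
replace (- sin y + _ + _) with (- (sin y - y)) by ring.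
rewrite !Rabs_Ropp, (Rabs_pos_eq (1 - cos y)) by lra. simpl in *. lra.
Qed.

Lemma Cmod_pow_sub_le (u v : C) k r : 1 <= r -> Cmod u <= r -> Cmod v <= r ->
  Cmod (u ^ k - v ^ k) <= INR k * Cmod (u - v) * r ^ k.
Proof.
intros Hr Hu Hv. induction k as [|k IH].
- simpl. replace (1 - 1)%C with (RtoC 0) by (apply injective_projections; simpl; ring).
  rewrite Cmod_0; lra.
- rewrite !Cpow_S.
  replace (u * u ^ k - v * v ^ k)%C with ((u - v) * u ^ k + v * (u ^ k - v ^ k))%C by ring.
  eapply Rle_trans; [apply Cmod_triangle|]. rewrite !Cmod_mult, Cmod_pow, S_INR.
  pose proof (Cmod_ge_0 (u - v)) as H0. pose proof (Cmod_ge_0 v).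
  pose proof (Cmod_ge_0 (u ^ k - v ^ k)).
  assert (Cmod u ^ k <= r ^ k) by (apply pow_incr; split; [apply Cmod_ge_0|auto]).
  assert (Hrk : 1 <= r ^ k) by now apply pow_R1_Rle.
  assert (Cmod (u - v) * Cmod u ^ k <= Cmod (u - v) * r ^ S k).
  { apply Rmult_le_compat_l; auto. simpl. nra. }
  assert (Cmod v * Cmod (u ^ k - v ^ k) <= r * (INR k * Cmod (u - v) * r ^ k))
    by (apply Rmult_le_compat; auto).
  simpl pow in *. lra.
Qed.

(** * Saddle point expansion *)

(** This is the real part of 1/(1-x) - 1/(1-q) at q = x e^(i th). *)
Lemma geometric_cos_gap x th : 0 <= x < 1 ->
  / (1 - x) - cos_series (fun _ => 1) x th =
  x * (1 + x) * (1 - cos th) / ((1 - x) * ((1 - x) ^ 2 + 2 * x * (1 - cos th))).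
Proof.
intros Hx. assert (Hax : Rabs x < 1) by (rewrite Rabs_pos_eq; lra).
assert (Hc : ex_series (fun n => 1 * cos (INR n * th) * x ^ n)).
{ apply (unit_radius_ex_series (fun n => 1 * cos (INR n * th))); auto.
  apply (cos_radius (fun _ => 1)), unit_radius_const. }
assert (Hs : ex_series (fun n => 1 * sin (INR n * th) * x ^ n)).
{ apply (unit_radius_ex_series (fun n => 1 * sin (INR n * th))); auto.
  apply (sin_radius (fun _ => 1)), unit_radius_const. }
unfold cos_series, PSeries.
set (c := Series (fun n => 1 * cos (INR n * th) * x ^ n)).
set (s := Series (fun n => 1 * sin (INR n * th) * x ^ n)).
(* [E1] and [E2] are the real and imaginary parts of S = 1 + q S for the geometric series S;
   eliminating [s] yields [c]. *)
assert (E1 : c = 1 + x * (cos th * c - sin th * s)).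
{ unfold c at 1. rewrite Series_incr_1 by auto. simpl (INR 0).
  rewrite Rmult_0_l, cos_0. f_equal; [simpl; ring|].
  unfold c, s. rewrite <- !Series_scal_l, <- Series_minus, <- Series_scal_l.
  - apply Series_ext; intros n.
    rewrite S_INR, Rmult_plus_distr_r, (Rmult_1_l th), cos_plus. simpl; ring.
  - now apply (ex_series_scal (K := R_AbsRing) (V := R_NormedModule) (cos th)).
  - now apply (ex_series_scal (K := R_AbsRing) (V := R_NormedModule) (sin th)). }
assert (E2 : s = x * (sin th * c + cos th * s)).
{ unfold s at 1. rewrite Series_incr_1 by auto. simpl (INR 0).
  rewrite Rmult_0_l, sin_0, Rmult_0_r, Rmult_0_l, Rplus_0_l.
  unfold c, s. rewrite <- !Series_scal_l, <- Series_plus, <- Series_scal_l.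
  - apply Series_ext; intros n.
    rewrite S_INR, Rmult_plus_distr_r, (Rmult_1_l th), sin_plus. simpl; ring.
  - now apply (ex_series_scal (K := R_AbsRing) (V := R_NormedModule) (sin th)).
  - now apply (ex_series_scal (K := R_AbsRing) (V := R_NormedModule) (cos th)). }
pose proof (sin2_cos2 th) as Hsc. unfold Rsqr in Hsc.
pose proof (COS_bound th) as Hcb.
set (C := cos th) in *. set (S' := sin th) in *.
assert (HD : 0 < (1 - x) ^ 2 + 2 * x * (1 - C)).
{ apply Rplus_lt_le_0_compat; [apply pow_lt; lra|].
  apply Rmult_le_pos; lra. }
assert (E : c * ((1 - x) ^ 2 + 2 * x * (1 - C)) = 1 - x * C).
{ assert (s * (1 - x * C) = x * S' * c) by lra.
  assert (c * (1 - x * C) * (1 - x * C) = (1 - x * C) - x * S' * (s * (1 - x * C))).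
  { replace (c * (1 - x * C)) with (1 - x * S' * s) by lra. ring. }
  rewrite H in H0.
  replace (x * S' * (x * S' * c)) with (x * x * c * (S' * S')) in H0 by ring.
  replace (S' * S') with (1 - C * C) in H0 by lra. lra. }
replace c with ((1 - x * C) / ((1 - x) ^ 2 + 2 * x * (1 - C))).
- field. lra.
- rewrite <- E. field. lra.
Qed.

Section SaddlePoint.
Variables (f a : nat -> R) (K : R).
Hypothesis fa : euler_recurrence f a K.

Let logc := er_log f.

Lemma gen_fun_polar x th : 0 <= x < 1 ->
  gen_fun a x th =
    (exp (cos_series logc x th) * cis (sin_series logc x th))%C.
Proof.
intros Hx. destruct (er_exp_formula f a K fa x th Hx) as [H1 H2].
unfold gen_fun, cis. rewrite H1, H2. unfold logc.
apply injective_projections; simpl; ring.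
Qed.

Lemma PSeries_a_exp x : 0 <= x < 1 -> PSeries a x = exp (cos_series logc x 0).
Proof.
intros Hx. destruct (er_exp_formula f a K fa x 0 Hx) as [H1 _].
replace (PSeries a x) with (cos_series a x 0).
- rewrite H1. unfold logc. replace (sin_series _ _ _) with 0.
  + rewrite cos_0; ring.
  + symmetry. unfold sin_series. rewrite (PSeries_ext _ (fun _ => 0)).
    * apply PSeries_const_0.
    * intros n. rewrite Rmult_0_r, sin_0; ring.
- apply PSeries_ext. intros n. rewrite Rmult_0_r, cos_0; ring.
Qed.

Definition log_modulus x th := cos_series logc x th - cos_series logc x 0.
Definition phase x th := sin_series logc x th - PSeries f x * th.
Definition variance x := PSeries (fun j => INR j ^ 1 * f j) x.
Definition third_moment x := PSeries (fun j => INR j ^ 2 * f j) x.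

(** The saddle point equation is used here: the linear term of the argument of P(q) is exactly n th,
    so e^(-i n th) cancels it and [phase] starts at third order. *)
Lemma gen_fun_normalized x th n : 0 <= x < 1 -> PSeries f x = INR n ->
  (gen_fun a x th * cis (- (INR n * th)))%C =
  (PSeries a x * (exp (log_modulus x th) * cis (phase x th)))%C.
Proof.
intros Hx Hn. rewrite gen_fun_polar, PSeries_a_exp by auto.
unfold phase, log_modulus. rewrite Hn.
replace (sin_series logc x th - INR n * th) with
  (sin_series logc x th + - (INR n * th)) by ring.
rewrite cis_plus.
replace (cos_series logc x th) with
  (cos_series logc x 0 + (cos_series logc x th - cos_series logc x 0)) at 1 by ring.
rewrite exp_plus, RtoC_mult. ring.
Qed.

Lemma log_modulus_series x th : 0 <= x < 1 ->
  ex_series (fun j => logc j * (cos (INR j * th) - 1) * x ^ j) /\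
  log_modulus x th = Series (fun j => logc j * (cos (INR j * th) - 1) * x ^ j).
Proof.
intros Hx. assert (Hax : Rabs x < 1) by (rewrite Rabs_pos_eq; lra).
pose proof (unit_radius_ex_series _ x
  (cos_radius logc th (er_log_radius f a K fa)) Hax) as H1.
pose proof (unit_radius_ex_series _ x
  (cos_radius logc 0 (er_log_radius f a K fa)) Hax) as H2.
assert (E : forall j, logc j * cos (INR j * th) * x ^ j
    - logc j * cos (INR j * 0) * x ^ j = logc j * (cos (INR j * th) - 1) * x ^ j).
{ intros j. rewrite Rmult_0_r, cos_0. ring. }
split.
- apply (ex_series_ext _ _ E).
  now apply (ex_series_minus (K := R_AbsRing) (V := R_NormedModule)).
- unfold log_modulus, cos_series, PSeries. rewrite <- Series_minus by auto.
  now apply Series_ext.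
Qed.

Lemma moment_ex_series m x : 0 <= x < 1 ->
  ex_series (fun j => INR j ^ m * f j * x ^ j).
Proof.
intros Hx. apply (unit_radius_ex_series (fun j => INR j ^ m * f j)).
- apply (er_moment_radius f a K fa).
- rewrite Rabs_pos_eq; lra.
Qed.

Lemma log_weight j x y B : 0 <= x -> Rabs y <= B ->
  Rabs (logc j * y * x ^ j) <= logc j * B * x ^ j.
Proof.
intros Hx Hy. pose proof (er_log_bound f a K fa j) as [Hl _]. fold logc in Hl.
assert (0 <= x ^ j) by now apply pow_le.
rewrite !Rabs_mult, (Rabs_pos_eq (logc j)), (Rabs_pos_eq (x ^ j)) by auto.
apply Rmult_le_compat_r; auto. now apply Rmult_le_compat_l.
Qed.

(** A remainder |j th|^3 / 6 weighted by f(j)/j becomes j^2 f(j) |th|^3 / 6. It serves both the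
    cosine and the sine expansion. *)
Lemma third_moment_dominates x th (y : nat -> R) : 0 <= x < 1 ->
  (forall j, Rabs (y j) <= Rabs (INR j * th) ^ 3 / 6) ->
  Rabs (Series (fun j => logc j * y j * x ^ j)) <= third_moment x * Rabs th ^ 3 / 6.
Proof.
intros Hx Hy.
replace (third_moment x * Rabs th ^ 3 / 6) with (third_moment x * (Rabs th ^ 3 / 6)) by field.
unfold third_moment, PSeries. rewrite <- Series_scal_r. apply Series_abs_le.
- intros j. eapply Rle_trans; [apply log_weight; [lra|apply Hy]|].
  rewrite Rabs_mult, (Rabs_pos_eq (INR j)) by apply pos_INR.
  rewrite <- (er_natmul_log f a K fa j). unfold logc. right. field.
- apply ex_series_scal_r. now apply moment_ex_series.
Qed.

Lemma log_modulus_taylor x th : 0 <= x < 1 ->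
  Rabs (log_modulus x th + variance x * th ^ 2 / 2)
    <= third_moment x * Rabs th ^ 3 / 6.
Proof.
intros Hx. destruct (log_modulus_series x th Hx) as [He ->].
replace (variance x * th ^ 2 / 2) with (variance x * (th ^ 2 / 2)) by field.
unfold variance, PSeries.
rewrite <- Series_scal_r, <- Series_plus; auto.
- rewrite (Series_ext _ (fun j =>
    logc j * (cos (INR j * th) - 1 + (INR j * th) ^ 2 / 2) * x ^ j)).
  + apply third_moment_dominates; auto. intros j; apply cos_taylor.
  + intros j. rewrite <- (er_natmul_log f a K fa j) at 1. fold logc. field.
- apply ex_series_scal_r. now apply moment_ex_series.
Qed.

Lemma phase_taylor x th : 0 <= x < 1 ->
  Rabs (phase x th) <= third_moment x * Rabs th ^ 3 / 6.
Proof.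
intros Hx. assert (Hax : Rabs x < 1) by (rewrite Rabs_pos_eq; lra).
unfold phase, sin_series, PSeries. rewrite <- Series_scal_r, <- Series_minus.
- rewrite (Series_ext _ (fun j =>
    logc j * (sin (INR j * th) - INR j * th) * x ^ j)).
  + apply third_moment_dominates; auto. intros j; apply sin_taylor.
  + intros j. rewrite <- (er_natmul_log f a K fa j) at 1. fold logc. ring.
- apply (unit_radius_ex_series (fun n => logc n * sin (INR n * th))); auto.
  apply sin_radius, (er_log_radius f a K fa).
- apply ex_series_scal_r, unit_radius_ex_series; auto. apply (er_f_radius f a K fa).
Qed.

(* The exponent obtained when all the weights [f j / j] are replaced by their
   lower bound 1. *)
Definition gap x th := x * (1 + x) * (1 - cos th) /
  ((1 - x) * ((1 - x) ^ 2 + 2 * x * (1 - cos th))).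

Lemma log_modulus_le_gap x th : 0 <= x < 1 -> log_modulus x th <= - gap x th.
Proof.
intros Hx. assert (Hax : Rabs x < 1) by (rewrite Rabs_pos_eq; lra).
unfold gap. rewrite <- geometric_cos_gap by auto.
destruct (log_modulus_series x th Hx) as [He ->].
assert (H1 : ex_series (fun j => 1 * cos (INR j * th) * x ^ j)).
{ apply (unit_radius_ex_series (fun n => 1 * cos (INR n * th))); auto.
  apply (cos_radius (fun _ => 1)), unit_radius_const. }
assert (H2 : ex_series (fun j => 1 * x ^ j)).
{ apply (unit_radius_ex_series (fun _ => 1)); auto. apply unit_radius_const. }
rewrite <- PSeries_geom by auto. unfold cos_series, PSeries.
rewrite <- Series_minus, <- Series_opp; auto.
apply Ropp_le_cancel. rewrite <- !Series_opp.
apply Series_le.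
- intros j. pose proof (COS_bound (INR j * th)) as Hc.
  assert (Hxj : 0 <= x ^ j) by (apply pow_le; lra).
  destruct j as [|j].
  + simpl INR in *. rewrite Rmult_0_l, cos_0. lra.
  + assert (Hl : 1 <= logc (S j)).
    { unfold logc, er_log. pose proof (er_ge _ _ _ fa (S j)).
      assert (0 < INR (S j)) by (apply lt_0_INR; lia).
      apply Rle_div_r; lra. }
    replace (- (logc (S j) * (cos (INR (S j) * th) - 1) * x ^ S j))
      with (logc (S j) * ((1 - cos (INR (S j) * th)) * x ^ S j)) by ring.
    replace (- - (1 * x ^ S j - 1 * cos (INR (S j) * th) * x ^ S j))
      with ((1 - cos (INR (S j) * th)) * x ^ S j) by ring.
    assert (0 <= (1 - cos (INR (S j) * th)) * x ^ S j) by (apply Rmult_le_pos; lra).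
    split; auto. nra.
- now apply (ex_series_opp (K := R_AbsRing) (V := R_NormedModule)).
Qed.

(** By f(j) >= j the variance dominates the sum of j^2 x^j, which is x times [T 2]. Each of two Abel
    summations gains a factor 1/(1-x) over the geometric series, and x >= 1/2 gives the constant. *)
Lemma variance_lower x : 1 / 2 <= x < 1 -> / (2 * (1 - x) ^ 3) <= variance x.
Proof.
intros Hx. assert (Hax : Rabs x < 1) by (rewrite Rabs_pos_eq; lra).
set (T d := PSeries (fun n => (INR n + 1) ^ d) x).
assert (Hincr : forall d g, unit_radius g ->
  (forall n, 0 <= g n <= (INR n + 1) ^ d - PS_incr_1 (fun n => (INR n + 1) ^ d) n) ->
  PSeries g x <= (1 - x) * T d).
{ intros d g Hg H. unfold T.
  rewrite <- PSeries_increments by (auto; apply unit_radius_pow).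
  apply PSeries_le; auto; [lra|].
  assert (Hd := unit_radius_pow d). unfold unit_radius.
  eapply Rbar_le_trans; [|apply (CV_radius_plus _ (PS_opp _))].
  rewrite CV_radius_opp, CV_radius_incr_1. unfold unit_radius in Hd.
  unfold Rbar_min. destruct (CV_radius _); auto. now apply Rmin_glb. }
assert (H1 : / (1 - x) <= (1 - x) * T 1%nat).
{ rewrite <- PSeries_geom by auto. apply Hincr; [apply unit_radius_const|].
  intros [|n].
  - change (0 <= 1 <= (0 + 1) ^ 1 - 0). simpl; lra.
  - change (0 <= 1 <= (INR (S n) + 1) ^ 1 - (INR n + 1) ^ 1). rewrite S_INR. simpl; lra. }
assert (H2 : T 1%nat <= (1 - x) * T 2%nat).
{ apply (Hincr 2%nat (fun n => (INR n + 1) ^ 1)); [apply unit_radius_pow|].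
  intros [|n].
  - change (0 <= (0 + 1) ^ 1 <= (0 + 1) ^ 2 - 0). simpl; lra.
  - change (0 <= (INR (S n) + 1) ^ 1 <= (INR (S n) + 1) ^ 2 - (INR n + 1) ^ 2).
    pose proof (pos_INR n). rewrite S_INR. simpl. nra. }
assert (H3 : x * T 2%nat <= variance x).
{ unfold T. rewrite <- PSeries_incr_1. apply PSeries_le; [lra|..].
  - apply (er_moment_radius f a K fa).
  - intros [|n].
    + simpl. change zero with 0. lra.
    + change (0 <= (INR n + 1) ^ 2 <= INR (S n) ^ 1 * f (S n)).
      pose proof (er_ge _ _ _ fa (S n)) as H. rewrite S_INR in *.
      pose proof (pos_INR n). simpl. nra. }
apply Rle_trans with (2 := H3).
assert (Hh : 0 < 1 - x) by lra.
apply Rle_trans with (/ 2 * T 2%nat).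
- apply (Rmult_le_reg_l ((1 - x) ^ 2)); [now apply pow_lt|].
  apply Rle_trans with (/ 2 * ((1 - x) * T 1%nat)); [|simpl; nra].
  apply Rle_trans with (/ 2 * / (1 - x)); [|lra].
  right. field. lra.
- apply Rmult_le_compat_r; [|lra].
  apply (Rmult_le_reg_l (1 - x)); auto. rewrite Rmult_0_r.
  eapply Rle_trans; [|exact H2].
  apply (Rmult_le_reg_l (1 - x)); auto. rewrite Rmult_0_r.
  eapply Rle_trans; [|exact H1]. left. now apply Rinv_0_lt_compat.
Qed.

End SaddlePoint.

(** * Gaussian approximation of the integrand *)

(** The gap is of order u/h^3 while u is below h^2, and at least of order 1/h beyond, where u/h^3
    can reach 2/h^3: this is what forces the cube. In the second case G >= 3/(16h), and 4 (16/3)^3 <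
    1000. *)
Lemma gap_cube_ge x th : 1 / 2 <= x < 1 ->
  0 <= gap x th /\
  1 + 2 * (1 - cos th) / (1 - x) ^ 3 <= 1000 * (1 + gap x th) ^ 3.
Proof.
intros Hx. unfold gap. pose proof (COS_bound th).
set (u := 1 - cos th). set (h := 1 - x).
assert (Hu : 0 <= u <= 2) by (unfold u; lra).
assert (Hh : 0 < h <= 1 / 2) by (unfold h; lra).
assert (Hh2 : 0 < h ^ 2) by (apply pow_lt; lra).
assert (Hh3 : 0 < h ^ 3) by (apply pow_lt; lra).
assert (Hd : 0 < h ^ 2 + 2 * x * u <= h ^ 2 + 2 * u) by nra.
assert (HG : 3 / 4 * u / (h * (h ^ 2 + 2 * u)) <=
  x * (1 + x) * u / (h * (h ^ 2 + 2 * x * u))).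
{ unfold Rdiv. apply Rmult_le_compat.
  - nra.
  - left. apply Rinv_0_lt_compat. apply Rmult_lt_0_compat; lra.
  - apply Rmult_le_compat_r; nra.
  - apply Rinv_le_contravar; [apply Rmult_lt_0_compat; lra|].
    apply Rmult_le_compat_l; lra. }
set (G := x * (1 + x) * u / (h * (h ^ 2 + 2 * x * u))) in *.
assert (HG0 : 0 <= G).
{ eapply Rle_trans; [|exact HG]. apply Rdiv_le_0_compat; [lra|].
  apply Rmult_lt_0_compat; lra. }
split; auto.
destruct (Rle_lt_dec (2 * u) (h ^ 2)) as [Hc|Hc].
- assert (H1 : 2 * u / h ^ 3 <= 16 / 3 * G).
  { apply Rle_trans with (16 / 3 * (3 / 4 * u / (h * (h ^ 2 + 2 * u)))); [|lra].
    apply Rle_div_l; auto.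
    replace (16 / 3 * (3 / 4 * u / (h * (h ^ 2 + 2 * u))) * h ^ 3)
      with (4 * u * (h ^ 2 / (h ^ 2 + 2 * u))) by (field; nra).
    assert (1 / 2 <= h ^ 2 / (h ^ 2 + 2 * u)) by (refine (proj1 (Rle_div_r _ _ _ _) _); lra).
    nra. }
  assert (1 + G <= (1 + G) ^ 3) by (simpl; nra). lra.
- assert (H1 : 3 / 16 / h <= G).
  { eapply Rle_trans; [|exact HG].
    refine (proj1 (Rle_div_r _ _ _ _) _); [apply Rmult_lt_0_compat; lra|].
    replace (3 / 16 / h * (h * (h ^ 2 + 2 * u))) with (3 / 16 * (h ^ 2 + 2 * u))
      by (field; lra). lra. }
  assert (H2 : (3 / 16 / h) ^ 3 <= G ^ 3).
  { apply pow_incr; split; auto. apply Rdiv_le_0_compat; lra. }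
  replace ((3 / 16 / h) ^ 3) with (27 / 4096 * / h ^ 3) in H2 by (field; lra).
  assert (0 < / h ^ 3) by now apply Rinv_0_lt_compat.
  assert (1 + G ^ 3 <= (1 + G) ^ 3) by (simpl; nra).
  unfold Rdiv. nra.
Qed.

(** The factors are exchanged one at a time: [z] for [e], then rho^r for 1, then W^k for (-it)^k.
    The exponent r + 6 collects T^3 from the first exchange, T^r from rho^r and at most T^3 from
    W^k. *)
Lemma product_error (z rho W : C) (e t s T Q c : R) r k :
  T = 1 + t ^ 2 -> 0 <= s <= 1 -> 0 <= e <= Q -> 0 <= c ->
  Cmod z <= Q -> Cmod (z - e) <= c * s * T ^ 3 * Q ->
  Cmod (rho - 1) <= 2 * s * T ->
  Cmod W <= T -> Cmod (W + Ci * t) <= 2 * s * T -> (k <= 3)%nat ->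
  Cmod (z * rho ^ r * W ^ k - e * (- (Ci * t)) ^ k) <=
    (c * 3 ^ r + 2 * INR r * 3 ^ r + 6) * s * Q * T ^ (r + 6).
Proof.
intros HT Hs He Hc Hz Hze Hrho HW HWt Hk.
assert (HT1 : 1 <= T) by (pose proof (pow2_ge_0 t); lra).
assert (HtT : Rabs t <= T) by (rewrite HT, <- pow2_abs; pose proof (Rabs_pos t); nra).
assert (HQ : 0 <= Q) by lra.
assert (Hr3 : Cmod rho <= 3 * T).
{ replace rho with ((rho - 1) + 1)%C by ring.
  eapply Rle_trans; [apply Cmod_triangle|]. rewrite Cmod_1. nra. }
assert (Hrr : Cmod (rho ^ r) <= 3 ^ r * T ^ r).
{ rewrite Cmod_pow, <- Rpow_mult_distr. apply pow_incr.
  split; [apply Cmod_ge_0|auto]. }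
assert (Hrr1 : Cmod (rho ^ r - 1) <= 2 * INR r * 3 ^ r * s * T * T ^ r).
{ replace (RtoC 1) with (1 ^ r)%C by apply Cpow_1_l.
  eapply Rle_trans; [apply (Cmod_pow_sub_le _ _ _ (3 * T)); auto; [lra|rewrite Cmod_1; lra]|].
  rewrite Rpow_mult_distr.
  replace (2 * INR r * 3 ^ r * s * T * T ^ r) with
    (INR r * (2 * s * T) * (3 ^ r * T ^ r)) by ring.
  apply Rmult_le_compat_r; [apply Rmult_le_pos; apply pow_le; lra|].
  apply Rmult_le_compat_l; [apply pos_INR|auto]. }
assert (HWk : Cmod (W ^ k) <= T ^ k).
{ rewrite Cmod_pow. apply pow_incr; split; [apply Cmod_ge_0|auto]. }
assert (Hit : Cmod (- (Ci * t)) <= T).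
{ rewrite Cmod_opp, Cmod_mult, Cmod_Ci, Cmod_R; lra. }
assert (Hdk : Cmod (W ^ k - (- (Ci * t)) ^ k) <= 6 * s * T * T ^ k).
{ eapply Rle_trans; [apply (Cmod_pow_sub_le _ _ _ T); auto|].
  apply Rmult_le_compat_r; [apply pow_le; lra|].
  replace (W - - (Ci * t))%C with (W + Ci * t)%C by ring.
  assert (INR k <= 3) by (apply le_INR in Hk; simpl in Hk; lra).
  pose proof (pos_INR k). pose proof (Cmod_ge_0 (W + Ci * t)). nra. }
assert (HTp : forall i, (i <= r + 6)%nat -> 0 <= T ^ i <= T ^ (r + 6)).
{ intros i Hi; split; [apply pow_le; lra|now apply Rle_pow]. }
replace (z * rho ^ r * W ^ k - e * (- (Ci * t)) ^ k)%C with
  ((z - e) * (rho ^ r * W ^ k) + (e * ((rho ^ r - 1) * W ^ k)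
   + e * (W ^ k - (- (Ci * t)) ^ k)))%C by ring.
eapply Rle_trans; [apply Cmod_triangle|].
apply Rle_trans with ((c * s * T ^ 3 * Q) * (3 ^ r * T ^ r * T ^ k) +
  (Q * (2 * INR r * 3 ^ r * s * T * T ^ r * T ^ k) + Q * (6 * s * T * T ^ k))).
- apply Rplus_le_compat.
  + rewrite !Cmod_mult. apply Rmult_le_compat; auto using Cmod_ge_0.
    * apply Rmult_le_pos; apply Cmod_ge_0.
    * apply Rmult_le_compat; auto using Cmod_ge_0.
  + eapply Rle_trans; [apply Cmod_triangle|]. rewrite !Cmod_mult, !Cmod_R.
    rewrite (Rabs_pos_eq e) by lra.
    apply Rplus_le_compat; (apply Rmult_le_compat; [lra| |lra|]);
      auto using Cmod_ge_0.
    * apply Rmult_le_pos; apply Cmod_ge_0.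
    * apply Rmult_le_compat; auto using Cmod_ge_0.
- assert (H3r : 0 < 3 ^ r) by (apply pow_lt; lra).
  assert (E1 : c * s * T ^ 3 * Q * (3 ^ r * T ^ r * T ^ k) <=
    c * 3 ^ r * s * Q * T ^ (r + 6)).
  { replace (c * s * T ^ 3 * Q * (3 ^ r * T ^ r * T ^ k)) with
      (c * 3 ^ r * s * Q * T ^ (3 + r + k)) by (rewrite !pow_add; ring).
    apply Rmult_le_compat_l; [|apply HTp; lia].
    repeat apply Rmult_le_pos; lra. }
  assert (E2 : Q * (2 * INR r * 3 ^ r * s * T * T ^ r * T ^ k) <=
    2 * INR r * 3 ^ r * s * Q * T ^ (r + 6)).
  { replace (Q * (2 * INR r * 3 ^ r * s * T * T ^ r * T ^ k)) with
      (2 * INR r * 3 ^ r * s * Q * T ^ (1 + r + k)) by (rewrite !pow_add; ring).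
    apply Rmult_le_compat_l; [|apply HTp; lia].
    repeat apply Rmult_le_pos; try lra. apply pos_INR. }
  assert (E3 : Q * (6 * s * T * T ^ k) <= 6 * s * Q * T ^ (r + 6)).
  { replace (Q * (6 * s * T * T ^ k)) with
      (6 * s * Q * T ^ (1 + k)) by (rewrite !pow_add; ring).
    apply Rmult_le_compat_l; [|apply HTp; lia].
    repeat apply Rmult_le_pos; lra. }
  lra.
Qed.

Section Integrand.
Variables (f a : nat -> R) (K : R).
Hypothesis fa : euler_recurrence f a K.

(** The constant of [exp_decay] at m = r + 7, one more than the exponent lost in [product_error], so
    that an integrable 1/(1 + t^2) remains. *)
Definition decay_const r := (1000 * (1 + 24 * K) * (3 * INR (r + 7)) ^ 3) ^ (r + 7).
Definition error_const r :=
  (192 * K * 3 ^ r + 2 * INR r * 3 ^ r + 6) * decay_const r.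

(* The error is [sqrt (1 - x)] times an integrable kernel on the whole circle,
   so no separate treatment of the minor arcs is needed. *)
Lemma integrand_estimate x th r k :
  1 / 2 <= x < 1 -> Rabs th <= PI -> (k <= 3)%nat ->
  let kap := sqrt (variance f x) in
  let t := kap * th in
  Cmod (exp (log_modulus f x th) * cis (phase f x th)
          * ((1 - x * cis th) / (1 - x)%R) ^ r * (kap * (cis (- th) - 1)) ^ k
        - exp (- (t ^ 2 / 2)) * (- (Ci * t)) ^ k)
    <= error_const r * sqrt (1 - x) / (1 + t ^ 2).
Proof.
intros Hx Hth Hk kap t.
assert (Hx' : 0 <= x < 1) by lra.
pose proof (er_K_pos f a K fa) as HK.
pose proof (variance_lower f a K fa x Hx) as HV.
pose proof (er_moment_le f a K fa 1 x Hx') as HV2. fold (variance f x) in HV2.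
pose proof (er_moment_le f a K fa 2 x Hx') as HM. fold (third_moment f x) in HM.
pose proof (log_modulus_taylor f a K fa x th Hx') as HA.
pose proof (phase_taylor f a K fa x th Hx') as HB.
pose proof (log_modulus_le_gap f a K fa x th Hx') as HG.
destruct (gap_cube_ge x th Hx) as [HG0 HGc].
pose proof (one_sub_cos_ge th Hth) as Hcos.
replace (INR (fact (1 + 2))) with 6 in HV2 by (simpl; lra).
replace (INR (fact (2 + 2))) with 24 in HM by (simpl; lra).
simpl plus in HV2, HM.
set (h := 1 - x) in *. assert (Hh : 0 < h <= 1 / 2) by (unfold h; lra).
set (s := sqrt h). assert (Hs0 : 0 < s) by (apply sqrt_lt_R0; lra).
assert (Hsh : s * s = h) by (apply sqrt_sqrt; lra).
assert (Hs1 : s <= 1) by nra.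
assert (Hh3 : 0 < h ^ 3) by (apply pow_lt; lra).
assert (HV0 : 0 < variance f x).
{ eapply Rlt_le_trans; [|exact HV]. apply Rinv_0_lt_compat. lra. }
assert (Hk0 : 0 < kap) by now apply sqrt_lt_R0.
assert (Hkk : kap * kap = variance f x) by (apply sqrt_sqrt; lra).
assert (Ht2 : t ^ 2 = variance f x * th ^ 2) by (unfold t; rewrite <- Hkk; ring).
(* The lower bound on the variance in terms of the small parameter s = sqrt h; it yields |th| <= 2
   s^3 |t|, the source of every power of [s] below. *)
assert (Hks : 1 <= 2 * s ^ 3 * kap).
{ assert (HH : 1 <= (2 * s ^ 3 * kap) * (2 * s ^ 3 * kap)).
  { replace ((2 * s ^ 3 * kap) * (2 * s ^ 3 * kap)) with
      (4 * (s * s) ^ 3 * (kap * kap)) by ring.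
    rewrite Hsh, Hkk.
    apply Rle_trans with (4 * h ^ 3 * / (2 * h ^ 3));
      [replace (4 * h ^ 3 * / (2 * h ^ 3)) with 2 by (field; lra); lra|].
    apply Rmult_le_compat_l; lra. }
  assert (0 <= 2 * s ^ 3 * kap).
  { assert (0 < s ^ 3) by (apply pow_lt; lra). nra. }
  nra. }
assert (Hab : Rabs t = kap * Rabs th).
{ unfold t. rewrite Rabs_mult, (Rabs_pos_eq kap); lra. }
assert (Hthb : Rabs th <= 2 * s ^ 3 * Rabs t).
{ rewrite Hab. pose proof (Rabs_pos th). nra. }
set (T := 1 + t ^ 2).
assert (HT1 : 1 <= T) by (unfold T; pose proof (pow2_ge_0 t); lra).
assert (HtT : Rabs t <= T) by (unfold T; rewrite <- pow2_abs; pose proof (Rabs_pos t); nra).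
set (L := 1000 * (1 + 24 * K)).
set (Q := decay_const r / T ^ (r + 7)).
(* The bounds variance <= 6K/h^3 and th^2 <= 7 (1 - cos th) give t^2 <= 21 K * 2 (1 - cos th)/h^3;
   the factor 1 + 24 K covers this and the summand 1. *)
assert (HTL : T <= L * (1 + gap x th) ^ 3).
{ apply Rle_trans with ((1 + 24 * K) * (1 + 2 * (1 - cos th) / h ^ 3)).
  2: { unfold L. replace (1000 * (1 + 24 * K) * (1 + gap x th) ^ 3) with
      ((1 + 24 * K) * (1000 * (1 + gap x th) ^ 3)) by ring.
      apply Rmult_le_compat_l; lra. }
  unfold T. rewrite Ht2.
  assert (variance f x * th ^ 2 <= (K * 6 / h ^ 3) * (7 * (1 - cos th))).
  { apply Rmult_le_compat; auto; try lra. apply pow2_ge_0. }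
  replace (K * 6 / h ^ 3 * (7 * (1 - cos th))) with
    (21 * K * (2 * (1 - cos th) / h ^ 3)) in H by (field; lra).
  assert (0 <= 2 * (1 - cos th) / h ^ 3).
  { apply Rdiv_le_0_compat; auto. pose proof (COS_bound th); lra. }
  nra. }
assert (HL : 1000 <= L) by (unfold L; lra).
assert (HQ1 : exp (- gap x th) <= Q).
{ apply exp_decay; auto; try lra. lia. }
assert (HQ2 : exp (- (t ^ 2 / 2)) <= Q).
{ apply exp_decay; try lra; [lia|pose proof (pow2_ge_0 t); lra|].
  pose proof (pow2_ge_0 t) as H2. set (y := t ^ 2 / 2) in *.
  replace T with (1 + 2 * y) by (unfold T, y; field).
  assert (0 <= y) by (unfold y; lra).
  assert (1 + y <= (1 + y) ^ 3) by (simpl; nra). nra. }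
assert (HQ0 : exp (log_modulus f x th) <= Q).
{ apply Rle_trans with (2 := HQ1).
  destruct HG as [HG|HG]; [left; now apply exp_increasing|rewrite HG; lra]. }
(* Here 192 = 24 * 2^3, and h^-4 (s^3)^3 = s leaves the single factor sqrt h. *)
assert (HM3 : third_moment f x * Rabs th ^ 3 <= 192 * K * s * T ^ 3).
{ apply Rle_trans with (K * 24 / h ^ 4 * (2 * s ^ 3 * Rabs t) ^ 3).
  - apply Rmult_le_compat; auto.
    + unfold third_moment. rewrite <- (PSeries_const_0 x). apply PSeries_le; auto.
      * apply (er_moment_radius f a K fa).
      * intros n; split; [lra|]. apply Rmult_le_pos; [apply pow_le, pos_INR|].
        apply (er_f_pos f a K fa).
    + apply pow_le, Rabs_pos.
    + apply pow_incr; split; [apply Rabs_pos|auto].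
  - rewrite <- Hsh. replace (K * 24 / (s * s) ^ 4 * (2 * s ^ 3 * Rabs t) ^ 3) with
      (192 * K * s * Rabs t ^ 3) by (field; lra).
    apply Rmult_le_compat_l; [apply Rmult_le_pos; lra|].
    apply pow_incr; split; [apply Rabs_pos|auto]. }
assert (Hz : Cmod (exp (log_modulus f x th) * cis (phase f x th)) <= Q).
{ rewrite Cmod_mult, Cmod_cis, Cmod_R, Rabs_pos_eq; [lra|left; apply exp_pos]. }
pose proof (exp_pos (log_modulus f x th)) as Hexp.
pose proof (exp_pos (- (t ^ 2 / 2))) as Hexp2.
assert (Herr : Cmod (exp (log_modulus f x th) * cis (phase f x th) - exp (- (t ^ 2 / 2)))
   <= 192 * K * s * T ^ 3 * Q).
{ replace (exp (log_modulus f x th) * cis (phase f x th) - exp (- (t ^ 2 / 2)))%C with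
   (exp (log_modulus f x th) * (cis (phase f x th) - 1) +
    (exp (log_modulus f x th) - exp (- (t ^ 2 / 2)))%R)%C
   by (rewrite RtoC_minus; ring).
  eapply Rle_trans; [apply Cmod_triangle|].
  rewrite Cmod_mult, !Cmod_R, (Rabs_pos_eq (exp (log_modulus f x th))) by lra.
  pose proof (Cmod_cis_sub_1 (phase f x th)) as H1.
  pose proof (exp_sub_le _ _ Q HQ0 HQ2) as H2.
  replace (log_modulus f x th - - (t ^ 2 / 2)) with
    (log_modulus f x th + variance f x * th ^ 2 / 2) in H2 by (rewrite Ht2; field).
  assert (exp (log_modulus f x th) * Cmod (cis (phase f x th) - 1) <=
    Q * (192 * K * s * T ^ 3 / 6)).
  { apply Rmult_le_compat; try lra. apply Cmod_ge_0. }
  assert (Rabs (log_modulus f x th + variance f x * th ^ 2 / 2) * Q <=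
     (192 * K * s * T ^ 3 / 6) * Q) by (apply Rmult_le_compat_r; lra).
  assert (0 <= 192 * K * s * T ^ 3 * Q).
  { assert (0 <= T ^ 3) by (apply pow_le; lra).
    assert (0 <= K * s) by (apply Rmult_le_pos; lra).
    apply Rmult_le_pos; [apply Rmult_le_pos|]; lra. }
  lra. }
assert (Hrho : Cmod ((1 - x * cis th) / h - 1) <= 2 * s * T).
{ assert (Hhc : RtoC h <> RtoC 0) by (intros E; apply RtoC_inj in E; lra).
  replace ((1 - x * cis th) / h - 1)%C with ((- (x / h)%R) * (cis th - 1))%C.
  2:{ rewrite RtoC_div by lra. replace (RtoC x) with (1 - h)%C
        by (rewrite <- RtoC_minus; unfold h; f_equal; ring).
      field. auto. }
  rewrite Cmod_mult, Cmod_opp, Cmod_R, Rabs_pos_eq by (apply Rdiv_le_0_compat; lra).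
  pose proof (Cmod_cis_sub_1 th). apply Rle_trans with (/ h * (2 * s ^ 3 * T)).
  - apply Rmult_le_compat; try apply Cmod_ge_0.
    + apply Rdiv_le_0_compat; lra.
    + unfold Rdiv. rewrite <- (Rmult_1_l (/ h)) at 2. apply Rmult_le_compat_r; [|lra].
      left. apply Rinv_0_lt_compat; lra.
    + eapply Rle_trans; [eassumption|]. eapply Rle_trans; [exact Hthb|].
      apply Rmult_le_compat_l; auto. apply Rmult_le_pos; [lra|apply pow_le; lra].
  - rewrite <- Hsh. right. field. lra. }
assert (HW : Cmod (kap * (cis (- th) - 1)) <= T).
{ rewrite Cmod_mult, Cmod_R, Rabs_pos_eq by lra.
  pose proof (Cmod_cis_sub_1 (- th)) as H. rewrite Rabs_Ropp in H.
  apply Rle_trans with (2 := HtT). rewrite Hab. apply Rmult_le_compat_l; lra. }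
assert (HWt : Cmod (kap * (cis (- th) - 1) + Ci * t) <= 2 * s * T).
{ unfold t. rewrite RtoC_mult.
  replace (kap * (cis (- th) - 1) + Ci * (kap * th))%C with
    (kap * (cis (- th) - 1 + Ci * th))%C by ring.
  rewrite Cmod_mult, Cmod_R, Rabs_pos_eq by lra.
  pose proof (Cmod_cis_linear th) as H.
  apply Rle_trans with (kap * th ^ 2); [apply Rmult_le_compat_l; lra|].
  rewrite <- pow2_abs.
  apply Rle_trans with (kap * (Rabs th * (2 * s ^ 3 * Rabs t))).
  - apply Rmult_le_compat_l; [lra|]. simpl. rewrite Rmult_1_r.
    apply Rmult_le_compat_l; [apply Rabs_pos|exact Hthb].
  - replace (kap * (Rabs th * (2 * s ^ 3 * Rabs t))) with
      (2 * s ^ 3 * ((kap * Rabs th) * Rabs t)) by ring.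
    rewrite <- Hab. replace (Rabs t * Rabs t) with (t ^ 2) by (rewrite <- pow2_abs; ring).
    apply Rmult_le_compat; [|apply pow2_ge_0| |unfold T; lra].
    + apply Rmult_le_pos; [lra|apply pow_le; lra].
    + simpl. nra. }
eapply Rle_trans.
- eapply (product_error _ _ _ _ t s T Q (192 * K) r k); auto; lra.
- unfold Q, error_const. rewrite (pow_add T r 7), (pow_add T r 6).
  assert (T ^ r <> 0) by (apply pow_nonzero; lra).
  right. field. split; auto; lra.
Qed.

End Integrand.

(** * Turan inequality for higher differences *)

Definition pdiff (b : nat -> R) (n : nat) : R := b n - b (pred n).
Definition fdiff (b : nat -> R) (n : nat) : R := b (S n) - b n.

Lemma fourier_seq_ext g g' u n0 : (forall th, g th = g' th) ->
  fourier_seq g u n0 -> fourier_seq g' u n0.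
Proof.
intros E H n Hn. apply is_RInt_ext with (2 := H n Hn).
intros th _. now rewrite E.
Qed.

Lemma fourier_seq_pdiff a x r : (forall n, 0 <= a n) -> unit_radius a -> 0 <= x < 1 ->
  fourier_seq (fun th => gen_fun a x th * (1 - x * cis th) ^ r)%C
    (fun n => Nat.iter r pdiff a n * x ^ n) r.
Proof.
intros Ha Hu Hx. induction r as [|r IH].
- apply fourier_seq_ext with (2 := fourier_seq_gen_fun a x Ha Hu Hx).
  intros th. simpl. ring.
- eapply fourier_seq_ext; [|apply (fourier_seq_diff _ _ _ x _ IH)].
  + intros th. rewrite Cpow_S. ring.
  + intros n. simpl. unfold pdiff at 1. simpl. ring.
Qed.

Lemma fourier_seq_fdiff g u n0 k : fourier_seq g u n0 ->
  fourier_seq (fun th => g th * (cis (- th) - 1) ^ k)%C (Nat.iter k fdiff u) n0.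
Proof.
intros H. induction k as [|k IH].
- apply fourier_seq_ext with (2 := H). intros th. simpl. ring.
- eapply fourier_seq_ext; [|apply (fourier_seq_shift _ _ _ IH)].
  intros th. rewrite Cpow_S. ring.
Qed.

(** The antiderivative is atan(kap th), so the bound PI <= 4 is uniform in [kap]. *)
Lemma is_RInt_cauchy_kernel kap : 0 < kap -> exists I, 0 <= I <= 4 /\
  is_RInt (fun th => kap / (1 + (kap * th) ^ 2)) (- PI) PI I.
Proof.
intros Hk. exists (atan (kap * PI) - atan (kap * - PI)). split.
- replace (kap * - PI) with (- (kap * PI)) by ring. rewrite atan_opp.
  pose proof (atan_bound (kap * PI)). pose proof PI_4. pose proof PI_RGT_0.
  assert (0 <= atan (kap * PI)).
  { rewrite <- atan_0. left. apply atan_increasing. now apply Rmult_lt_0_compat. }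
  lra.
- apply (is_RInt_derive (fun th => atan (kap * th))).
  + intros y _. auto_derive; auto. unfold Rsqr. field.
    pose proof (pow2_ge_0 (kap * y)). simpl in *. nra.
  + intros y _. apply (ex_derive_continuous (fun th => kap / (1 + (kap * th) ^ 2))).
    auto_derive. pose proof (pow2_ge_0 (kap * y)). simpl in *. nra.
Qed.

Lemma rescaled_ex_RInt (g : R -> R) kap : (forall t, continuous g t) ->
  forall b c, ex_RInt (fun th => kap * g (kap * th)) b c.
Proof.
intros Hg b c. apply (ex_RInt_continuous (V := R_CompleteNormedModule)).
intros z _. apply (continuous_scal_r kap (fun th => g (kap * th))).
apply continuous_comp; auto.
apply (ex_derive_continuous (fun th => kap * th)). auto_derive; auto.
Qed.

(** Only the window 1/2 <= t <= 1 is kept; kap >= 1 ensures that it lies inside the circle after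
    rescaling. This avoids evaluating Gaussian integrals. *)
Lemma rescaled_RInt_ge (g : R -> R) kap m : 1 <= kap -> (forall t, continuous g t) ->
  (forall t, 0 <= g t) -> (forall t, / 2 <= t <= 1 -> m <= g t) ->
  m / 2 <= RInt (fun th => kap * g (kap * th)) (- PI) PI.
Proof.
intros Hk Hc Hg Hm. set (G := fun th => kap * g (kap * th)).
assert (HG : forall b c, ex_RInt G b c) by now apply rescaled_ex_RInt.
assert (HG0 : forall th, 0 <= G th) by (intros; apply Rmult_le_pos; auto; lra).
pose proof PI2_1 as HPI.
assert (Hik : 0 < / kap <= 1).
{ split; [apply Rinv_0_lt_compat; lra|].
  rewrite <- Rinv_1. apply Rinv_le_contravar; lra. }
rewrite <- (RInt_Chasles G (- PI) (/ kap / 2) PI) by auto.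
rewrite <- (RInt_Chasles G (/ kap / 2) (/ kap) PI) by auto.
change plus with Rplus.
assert (H1 : 0 <= RInt G (- PI) (/ kap / 2)) by (apply RInt_ge_0; auto; lra).
assert (H2 : 0 <= RInt G (/ kap) PI) by (apply RInt_ge_0; auto; lra).
assert (H3 : m / 2 <= RInt G (/ kap / 2) (/ kap)).
{ replace (m / 2) with (RInt (fun _ => kap * m) (/ kap / 2) (/ kap)).
  - apply RInt_le; auto; [lra|apply ex_RInt_const|].
    intros th Hth. unfold G. apply Rmult_le_compat_l; [lra|]. apply Hm.
    assert (E : kap * / kap = 1) by (apply Rinv_r; lra). split; nra.
  - rewrite RInt_const. change scal with Rmult. simpl. field. lra. }
lra.
Qed.

Definition turan_form (c0 c1 c2 c3 : R) : R :=
  4 * (c1 ^ 2 - c0 * c2) * (c2 ^ 2 - c1 * c3) - (c1 * c2 - c0 * c3) ^ 2.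

Lemma turan_form_pos d0 d1 d2 d3 : / 8 <= d0 <= 9 -> d2 <= - / 32 ->
  Rabs d1 <= / 10000 -> Rabs d3 <= / 10000 -> 0 < turan_form d0 d1 d2 d3.
Proof.
intros H0 H2 H1 H3. apply Rabs_le_between in H1. apply Rabs_le_between in H3.
unfold turan_form. set (q := - d2). replace d2 with (- q) by (unfold q; ring).
assert (Hq : / 32 <= q) by (unfold q; lra).
assert (A1 : q / 8 <= d1 ^ 2 - d0 * - q) by nra.
assert (A2 : q ^ 2 / 2 <= (- q) ^ 2 - d1 * d3) by nra.
assert (A3 : q / 8 * (q ^ 2 / 2) <=
  (d1 ^ 2 - d0 * - q) * ((- q) ^ 2 - d1 * d3)) by (apply Rmult_le_compat; nra).
assert (A4 : Rabs (d1 * - q - d0 * d3) <= / 10000 * (q + 9)).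
{ apply Rabs_le. split; nra. }
assert (A5 : (d1 * - q - d0 * d3) ^ 2 <= (/ 10000 * (q + 9)) ^ 2).
{ rewrite <- pow2_abs. apply pow_incr. split; [apply Rabs_pos|auto]. }
(* This fixes the tolerance 1/10000: at the smallest value q = 1/32 the two sides are about 0.00090
   and 0.00098. *)
assert (A6 : / 10000 * (q + 9) <= q / 32).
{ lra. }
assert (A7 : (/ 10000 * (q + 9)) ^ 2 <= (q / 32) ^ 2).
{ apply pow_incr; lra. }
assert (A8 : 4 * (q / 8 * (q ^ 2 / 2)) >= q ^ 2 / 128) by nra.
assert (0 < q ^ 2) by (apply pow_lt; lra).
replace ((q / 32) ^ 2) with (q ^ 2 / 1024) in A7 by field. lra.
Qed.

(* The form is the discriminant of a binary cubic, hence invariant under the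
   unipotent substitution that turns the coefficients into their differences. *)
Lemma turan_form_fdiff u n :
  turan_form (u n) (u (S n)) (u (S (S n))) (u (S (S (S n)))) =
  turan_form (u n) (fdiff u n) (fdiff (fdiff u) n) (fdiff (fdiff (fdiff u)) n).
Proof. unfold turan_form, fdiff. ring. Qed.

(** Geometric weights act on the cubic by a diagonal substitution. This removes both the powers of
    kappa in the limits and the tilt x^m. *)
Lemma turan_form_scale c s d0 d1 d2 d3 :
  turan_form (c * d0) (c * s * d1) (c * s ^ 2 * d2) (c * s ^ 3 * d3) =
  c ^ 4 * s ^ 6 * turan_form d0 d1 d2 d3.
Proof. unfold turan_form. ring. Qed.

Section HigherDifferences.
Variables (f a : nat -> R) (K : R).
Hypothesis fa : euler_recurrence f a K.

Lemma PSeries_a_pos x : 0 <= x < 1 -> 0 < PSeries a x.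
Proof. intros Hx. rewrite (PSeries_a_exp f a K fa x Hx). apply exp_pos. Qed.

(** Intermediate values between 0 and y = 1 - 1/(2M), with M = 2n + 2. One term suffices at y: f(M)
    >= M and y^M >= 1/2 by Bernoulli, so the series is at least n + 1. *)
Lemma saddle_exists n : (1 <= n)%nat ->
  exists x, 0 <= x < 1 /\ PSeries f x = INR n.
Proof.
intros Hn. set (M := (2 * n + 2)%nat).
assert (HM : 4 <= INR M) by (replace 4 with (INR 4) by (simpl; lra); apply le_INR; lia).
set (y := 1 - / (2 * INR M)).
assert (Hi : 0 < / (2 * INR M) <= / 8).
{ split; [apply Rinv_0_lt_compat; lra|apply Rinv_le_contravar; lra]. }
assert (Hy : 0 < y < 1) by (unfold y; lra).
assert (Hbern : forall k, 1 - INR k * / (2 * INR M) <= y ^ k).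
{ induction k as [|k IH]; [simpl; lra|]. rewrite S_INR. simpl.
  apply Rle_trans with (y * (1 - INR k * / (2 * INR M))).
  - unfold y. pose proof (pos_INR k). nra.
  - apply Rmult_le_compat_l; lra. }
assert (Hbig : INR n + 1 <= PSeries f y).
{ eapply Rle_trans; [|apply (PSeries_term_le f y M)]; auto; [|
   apply (er_f_pos f a K fa)|lra|apply (er_f_radius f a K fa)].
  apply Rle_trans with (f M * y ^ M).
  2: { apply (sum_f_R0_ge_term (fun k => f k * y ^ k)); auto.
       intros k. apply Rmult_le_pos; [apply (er_f_pos f a K fa)|apply pow_le; lra]. }
  specialize (Hbern M). replace (INR M * / (2 * INR M)) with (/ 2) in Hbern by (field; lra).
  pose proof (er_ge _ _ _ fa M).
  apply Rle_trans with (INR M * / 2).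
  - unfold M. rewrite plus_INR, mult_INR. simpl. lra.
  - apply Rmult_le_compat; lra. }
destruct (Ranalysis5.IVT_interv (fun x => PSeries f x - INR n) 0 y) as (x & Hx & E).
- intros z Hz. apply continuity_pt_minus.
  + apply PSeries_continuity, unit_radius_lt; [apply (er_f_radius f a K fa)|].
    rewrite Rabs_pos_eq; lra.
  + apply continuity_pt_const. now intros ? ?.
- lra.
- rewrite PSeries_0, (er_f0 _ _ _ fa). apply le_INR in Hn. change (INR 1) with 1 in Hn. lra.
- lra.
- exists x. split; lra.
Qed.

(** At the saddle point n is at most 2K/(1-x)^2, so x tends to 1 as n grows. *)
Lemma saddle_close eps : 0 < eps -> exists N : nat, forall n x, (N <= n)%nat ->
  0 <= x < 1 -> PSeries f x = INR n -> 1 - x <= eps.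
Proof.
intros He. destruct (INR_unbounded (2 * K / eps ^ 2)) as [N HN].
exists N. intros n x Hn Hx E. destruct (Rle_lt_dec (1 - x) eps) as [|Hlt]; auto.
exfalso. pose proof (er_moment_le f a K fa 0 x Hx) as H.
rewrite (PSeries_ext _ f) in H by (intros; simpl; ring).
rewrite E in H. replace (INR (fact (0 + 2))) with 2 in H by (simpl; lra).
change (0 + 2)%nat with 2%nat in H. pose proof (er_K_pos f a K fa) as HK.
assert (eps ^ 2 <= (1 - x) ^ 2) by (apply pow_incr; lra).
assert (0 < eps ^ 2) by (apply pow_lt; lra).
assert (K * 2 / (1 - x) ^ 2 <= 2 * K / eps ^ 2).
{ unfold Rdiv. rewrite (Rmult_comm K). apply Rmult_le_compat_l; [lra|].
  now apply Rinv_le_contravar. }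
apply le_INR in Hn. lra.
Qed.

(** Of the k + 1 factors [kap], k normalise (e^(-i th) - 1)^k and one is the Jacobian of t = kap th,
    kept inside the integral. The 4 bounds the integral of the Cauchy kernel. *)
Lemma scaled_difference x n r k (g : R -> R) :
  1 / 2 <= x < 1 -> PSeries f x = INR n -> (r <= n)%nat -> (k <= 3)%nat ->
  (forall t, continuous g t) ->
  (forall t : R, Re (exp (- (t ^ 2 / 2)) * (- (Ci * t)) ^ k) = g t) ->
  let kap := sqrt (variance f x) in
  Rabs (kap ^ S k * (2 * PI / (PSeries a x * (1 - x) ^ r))
          * Nat.iter k fdiff (fun n => Nat.iter r pdiff a n * x ^ n) n
        - RInt (fun th => kap * g (kap * th)) (- PI) PI)
    <= 4 * error_const K r * sqrt (1 - x).
Proof.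
intros Hx Hn Hr Hk Hc Hg kap. assert (Hx' : 0 <= x < 1) by lra.
pose proof (PSeries_a_pos x Hx') as HP.
assert (Hh : 0 < (1 - x) ^ r) by (apply pow_lt; lra).
assert (Hkap : 0 < kap).
{ apply sqrt_lt_R0. eapply Rlt_le_trans; [|apply (variance_lower f a K fa x Hx)].
  apply Rinv_0_lt_compat. assert (0 < (1 - x) ^ 3) by (apply pow_lt; lra). lra. }
set (c := kap ^ S k / (PSeries a x * (1 - x) ^ r)).
pose proof (fourier_seq_fdiff _ _ _ k (fourier_seq_pdiff a x r (er_pos _ _ _ fa)
  (er_a_radius f a K fa) Hx') n Hr) as H1.
cbv beta in H1. set (D := Nat.iter k fdiff _ n) in *.
apply (is_RInt_scal _ _ _ c) in H1.
pose proof (RInt_correct _ _ _ (rescaled_ex_RInt g kap Hc (- PI) PI)) as H2.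
pose proof (is_RInt_minus _ _ _ _ _ _ H1 H2) as H3.
destruct (is_RInt_cauchy_kernel kap Hkap) as (I & HI & H4).
apply (is_RInt_scal _ _ _ (error_const K r * sqrt (1 - x))) in H4.
replace (kap ^ S k * (2 * PI / (PSeries a x * (1 - x) ^ r)) * D) with (c * (2 * PI * D))
  by (unfold c; field; lra).
apply Rle_trans with (error_const K r * sqrt (1 - x) * I).
- eapply (norm_RInt_le (V := R_NormedModule) _ _ (- PI) PI); [|
   |exact H3|exact H4]; [pose proof PI_RGT_0; lra|].
  intros th Hth. cbv beta.
  change (Rabs (c * Re (gen_fun a x th * (1 - x * cis th) ^ r * (cis (- th) - 1) ^ k
     * cis (- (INR n * th))) - kap * g (kap * th)) <=
     error_const K r * sqrt (1 - x) * (kap / (1 + (kap * th) ^ 2))).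
  pose proof (integrand_estimate f a K fa x th r k Hx (Rabs_le _ _ Hth) Hk) as HE.
  cbv zeta in HE. fold kap in HE.
  set (Z := (exp (log_modulus f x th) * cis (phase f x th))%C) in *.
  set (X := ((1 - x * cis th) / (1 - x)%R)%C) in *.
  assert (E : (c * (gen_fun a x th * (1 - x * cis th) ^ r * (cis (- th) - 1) ^ k
     * cis (- (INR n * th))) =
    kap * (Z * X ^ r * (kap * (cis (- th) - 1)) ^ k))%C).
  { replace (gen_fun a x th * (1 - x * cis th) ^ r * (cis (- th) - 1) ^ k
     * cis (- (INR n * th)))%C with
      ((gen_fun a x th * cis (- (INR n * th))) * (1 - x * cis th) ^ r
        * (cis (- th) - 1) ^ k)%C by ring.
    rewrite (gen_fun_normalized f a K fa x th n Hx' Hn). fold Z.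
    assert (Hhc : RtoC (1 - x) <> RtoC 0) by (intros E; apply RtoC_inj in E; lra).
    replace (1 - x * cis th)%C with ((1 - x)%R * X)%C by (unfold X; field; auto).
    rewrite !Cpow_mult_l, <- !RtoC_pow. unfold c.
    rewrite RtoC_div by (apply Rgt_not_eq, Rmult_lt_0_compat; lra).
    simpl pow. rewrite !RtoC_mult. field.
    split; intros E; apply RtoC_inj in E; lra. }
  rewrite <- re_scal_l, E, re_scal_l, <- Hg, <- Rmult_minus_distr_l.
  rewrite Rabs_mult, (Rabs_pos_eq kap) by lra.
  replace (_ * (kap / _)) with
    (kap * (error_const K r * sqrt (1 - x) / (1 + (kap * th) ^ 2)))
    by (unfold Rdiv; ring).
  apply Rmult_le_compat_l; [lra|].
  eapply Rle_trans; [|exact HE].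
  eapply Rle_trans; [|apply re_le_Cmod]. right. f_equal.
- pose proof (er_K_pos f a K fa) as HK.
  assert (0 <= error_const K r * sqrt (1 - x)).
  { apply Rmult_le_pos; [|apply sqrt_pos]. unfold error_const, decay_const.
    assert (0 < 3 ^ r) by (apply pow_lt; lra). pose proof (pos_INR r).
    apply Rmult_le_pos.
    - assert (0 <= K * 3 ^ r) by (apply Rmult_le_pos; lra).
      assert (0 <= INR r * 3 ^ r) by (apply Rmult_le_pos; lra). lra.
    - apply pow_le, Rmult_le_pos; [lra|]. apply pow_le.
      pose proof (pos_INR (r + 7)); lra. }
  nra.
Qed.

Lemma turan_pdiff r : exists N : nat, forall n, (N <= n)%nat ->
  let b := Nat.iter r pdiff a in
  0 < turan_form (b n) (b (S n)) (b (S (S n))) (b (S (S (S n)))).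
Proof.
set (E := error_const K r).
(* The first entry gives x >= 1/2, the second makes 4 E sqrt(1-x) at most the tolerance 1/10000 of
   [turan_form_pos]. *)
set (eps := Rmin (/ 2) ((/ (40000 * (Rabs E + 1))) ^ 2)).
assert (HE : 0 < / (40000 * (Rabs E + 1))).
{ apply Rinv_0_lt_compat. pose proof (Rabs_pos E). lra. }
assert (Heps : 0 < eps) by (apply Rmin_pos; [lra|now apply pow_lt]).
destruct (saddle_close eps Heps) as [N HN].
exists (N + r + 1)%nat. intros n Hn b.
destruct (saddle_exists n ltac:(lia)) as (x & Hx' & Hxn).
pose proof (HN n x ltac:(lia) Hx' Hxn) as Hh.
assert (Hx : 1 / 2 <= x < 1) by (pose proof (Rmin_l (/ 2) ((/ (40000 * (Rabs E + 1))) ^ 2)); unfold eps in *; lra).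
assert (Herr : 4 * E * sqrt (1 - x) <= / 10000).
{ assert (Hs : sqrt (1 - x) <= / (40000 * (Rabs E + 1))).
  { rewrite <- (sqrt_pow2 (/ (40000 * (Rabs E + 1)))) by lra.
    apply sqrt_le_1_alt. eapply Rle_trans; [exact Hh|apply Rmin_r]. }
  pose proof (sqrt_pos (1 - x)). pose proof (Rle_abs E). pose proof (Rabs_pos E).
  apply Rle_trans with (4 * (Rabs E + 1) * / (40000 * (Rabs E + 1))).
  - apply Rle_trans with (4 * (Rabs E + 1) * sqrt (1 - x)).
    + apply Rmult_le_compat_r; lra.
    + apply Rmult_le_compat_l; lra.
  - right. field. lra. }
set (kap := sqrt (variance f x)).
assert (Hkap : 1 <= kap).
{ rewrite <- sqrt_1. apply sqrt_le_1_alt.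
  eapply Rle_trans; [|apply (variance_lower f a K fa x Hx)].
  rewrite <- Rinv_1. apply Rinv_le_contravar.
  - assert (0 < (1 - x) ^ 3) by (apply pow_lt; lra). lra.
  - assert ((1 - x) ^ 3 <= (1 / 2) ^ 3) by (apply pow_incr; lra). lra. }
set (w := 2 * PI / (PSeries a x * (1 - x) ^ r)).
assert (Hw : 0 < w).
{ apply Rdiv_lt_0_compat; [pose proof PI_RGT_0; lra|].
  apply Rmult_lt_0_compat; [now apply PSeries_a_pos|apply pow_lt; lra]. }
set (u := fun n => b n * x ^ n).
assert (Hd : forall k g, (k <= 3)%nat -> (forall t, continuous g t) ->
  (forall t : R, Re (exp (- (t ^ 2 / 2)) * (- (Ci * t)) ^ k) = g t) ->
  Rabs (kap ^ S k * w * Nat.iter k fdiff u n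
     - RInt (fun th => kap * g (kap * th)) (- PI) PI) <= / 10000).
{ intros k g Hk Hc Hg. apply Rle_trans with (2 := Herr).
  apply scaled_difference; auto. lia. }
set (g0 := fun t => exp (- (t ^ 2 / 2))).
set (g2 := fun t => t ^ 2 * exp (- (t ^ 2 / 2))).
assert (C0 : forall t, continuous g0 t).
{ intros t. apply (ex_derive_continuous g0). unfold g0. auto_derive; auto. }
assert (C2 : forall t, continuous g2 t).
{ intros t. apply (ex_derive_continuous g2). unfold g2. auto_derive; auto. }
assert (Hhalf : forall t, / 2 <= t <= 1 -> / 2 <= g0 t).
{ intros t Ht. unfold g0. pose proof (exp_ineq1_le (- (t ^ 2 / 2))). nra. }
assert (L0 : / 2 / 2 <= RInt (fun th => kap * g0 (kap * th)) (- PI) PI).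
{ apply rescaled_RInt_ge; auto. intros t; left; apply exp_pos. }
assert (L2 : / 8 / 2 <= RInt (fun th => kap * g2 (kap * th)) (- PI) PI).
{ apply rescaled_RInt_ge; auto.
  - intros t; apply Rmult_le_pos; [apply pow2_ge_0|left; apply exp_pos].
  - intros t Ht. specialize (Hhalf t Ht). unfold g2. fold (g0 t). nra. }
assert (U0 : RInt (fun th => kap * g0 (kap * th)) (- PI) PI <= 8).
{ destruct (is_RInt_cauchy_kernel kap ltac:(lra)) as (I & HI & HK).
  apply (is_RInt_scal _ _ _ 2) in HK.
  apply Rle_trans with (2 * I); [|lra].
  refine (is_RInt_le _ _ (- PI) PI _ _ _ (RInt_correct _ _ _ (rescaled_ex_RInt g0 kap C0 _ _)) HK _).
  - pose proof PI_RGT_0; lra.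
  - intros th _. change (kap * g0 (kap * th) <= 2 * (kap / (1 + (kap * th) ^ 2))).
    set (t := kap * th). replace (2 * (kap / (1 + t ^ 2))) with (kap * (2 / (1 + t ^ 2)))
      by (unfold Rdiv; ring).
    apply Rmult_le_compat_l; [lra|]. unfold g0. pose proof (pow2_ge_0 t).
    apply Rle_div_r; [lra|]. rewrite exp_Ropp.
    apply (Rmult_le_reg_l (exp (t ^ 2 / 2))); [apply exp_pos|].
    rewrite <- Rmult_assoc, Rinv_r, Rmult_1_l by (pose proof (exp_pos (t ^ 2 / 2)); lra).
    pose proof (exp_ineq1_le (t ^ 2 / 2)). lra. }
assert (Rk : RInt (fun _ : R => kap * 0) (- PI) PI = 0).
{ rewrite RInt_const. change scal with Rmult. simpl. ring. }
assert (D0 := Hd 0%nat g0 ltac:(lia) C0).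
(* For odd k the number (-it)^k is purely imaginary, so the limiting integrand is 0; for k = 2 it is
   -t^2 times the Gaussian. *)
assert (D1 := Hd 1%nat (fun _ => 0) ltac:(lia) (fun t => continuous_const _ _)).
assert (D2 := Hd 2%nat (fun t => - g2 t) ltac:(lia)
  (fun t => continuous_opp g2 t (C2 t))).
assert (D3 := Hd 3%nat (fun _ => 0) ltac:(lia) (fun t => continuous_const _ _)).
cbv beta in D1, D2, D3. rewrite Rk, Rminus_0_r in D1, D3.
assert (Eopp : RInt (fun th => kap * - g2 (kap * th)) (- PI) PI =
  - RInt (fun th => kap * g2 (kap * th)) (- PI) PI).
{ rewrite <- (RInt_opp (V := R_CompleteNormedModule)) by (apply rescaled_ex_RInt; auto).
  apply RInt_ext. intros t _. change opp with Ropp. simpl. ring. }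
rewrite Eopp in D2.
assert (F0 : Rabs (kap ^ 1 * w * u n -
   RInt (fun th => kap * g0 (kap * th)) (- PI) PI) <= / 10000).
{ apply D0. intros t. unfold g0. simpl. ring. }
assert (F1 : Rabs (kap ^ 2 * w * fdiff u n) <= / 10000).
{ apply D1. intros t. simpl. ring. }
assert (F2 : Rabs (kap ^ 3 * w * fdiff (fdiff u) n -
   - RInt (fun th => kap * g2 (kap * th)) (- PI) PI) <= / 10000).
{ apply D2. intros t. unfold g2. simpl. ring. }
assert (F3 : Rabs (kap ^ 4 * w * fdiff (fdiff (fdiff u)) n) <= / 10000).
{ apply D3. intros t. simpl. ring. }
apply Rabs_le_between in F0. apply Rabs_le_between in F2.
assert (P0 : / 8 <= kap ^ 1 * w * u n <= 9) by lra.
assert (P2 : kap ^ 3 * w * fdiff (fdiff u) n <= - / 32) by lra.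
assert (Hpos := turan_form_pos _ _ _ _ P0 P2 F1 F3).
replace (kap ^ 1 * w) with (kap * w) in Hpos by ring.
replace (kap ^ 2 * w) with ((kap * w) * kap) in Hpos by ring.
replace (kap ^ 3 * w) with ((kap * w) * kap ^ 2) in Hpos by ring.
replace (kap ^ 4 * w) with ((kap * w) * kap ^ 3) in Hpos by ring.
rewrite turan_form_scale, <- turan_form_fdiff in Hpos. unfold u in Hpos.
replace (b n * x ^ n) with (x ^ n * b n) in Hpos by ring.
replace (b (S n) * x ^ S n) with (x ^ n * x * b (S n)) in Hpos by (simpl; ring).
replace (b (S (S n)) * x ^ S (S n)) with (x ^ n * x ^ 2 * b (S (S n))) in Hpos by (simpl; ring).
replace (b (S (S (S n))) * x ^ S (S (S n))) with (x ^ n * x ^ 3 * b (S (S (S n)))) in Hpos by (simpl; ring).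
rewrite turan_form_scale in Hpos.
apply (Rmult_lt_reg_l ((x ^ n) ^ 4 * x ^ 6)).
{ apply Rmult_lt_0_compat; repeat apply pow_lt; lra. }
rewrite Rmult_0_r.
apply (Rmult_lt_reg_l ((kap * w) ^ 4 * kap ^ 6)).
{ apply Rmult_lt_0_compat; apply pow_lt; [apply Rmult_lt_0_compat|]; lra. }
rewrite Rmult_0_r. exact Hpos.
Qed.

End HigherDifferences.

End Analysis.

Require Import Defs.
From mathcomp Require Import all_boot all_order all_algebra.
From mathcomp Require Import Rstruct.

Import Order.TTheory GRing.Theory Num.Theory.

Module Partitions.
Set Implicit Arguments.
Unset Strict Implicit.
Unset Printing Implicit Defensive.
Local Open Scope nat_scope.

(** * Convolution *)

Section Convolution.
Implicit Types u v w : nat -> nat.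

Definition conv u v n := \sum_(i < n.+1) u i * v (n - i).

(** Truncating to polynomials lets commutativity and associativity of [conv] be inherited from the
    polynomial ring. *)
Lemma coef_mul_trunc N u v n : n < N ->
  (((\poly_(i < N) u i) * (\poly_(i < N) v i))`_n)%R = conv u v n.
Proof.
move=> ltnN; rewrite coefM; apply: eq_bigr => i _.
have lti : i < N := leq_ltn_trans (leq_ord i) ltnN.
by rewrite !coef_poly lti (leq_ltn_trans (leq_subr _ _) ltnN).
Qed.

Lemma convC u v n : conv u v n = conv v u n.
Proof. by rewrite -!(coef_mul_trunc _ _ (ltnSn n)) mulrC. Qed.

Lemma eq_conv u u' v v' n : (forall i, i <= n -> u i = u' i) ->
  (forall i, i <= n -> v i = v' i) -> conv u v n = conv u' v' n.
Proof.
move=> eq_u eq_v; apply: eq_bigr => i _.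
by rewrite eq_u ?leq_ord // eq_v // leq_subr.
Qed.

Lemma convA u v w n : conv u (conv v w) n = conv (conv u v) w n.
Proof.
have trunc s t (c := conv s t) (i : 'I_n.+1) :
  ((\poly_(i < n.+1) c i)`_i = ((\poly_(i < n.+1) s i) * (\poly_(i < n.+1) t i))`_i)%R.
  by rewrite coef_poly ltn_ord coef_mul_trunc.
rewrite -!(coef_mul_trunc _ _ (ltnSn n)) coefM [RHS]coefMr.
transitivity ((\poly_(i < n.+1) u i *
  (\poly_(i < n.+1) v i * \poly_(i < n.+1) w i))`_n)%R.
  rewrite coefM; apply: eq_bigr => i _; congr (_ * _)%R.
  exact: (trunc v w (rev_ord i)).
by rewrite mulrA coefMr; apply: eq_bigr => i _; rewrite -(trunc u v (rev_ord i)).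
Qed.

(** Leibniz rule for the derivation q d/dq, which multiplies the n-th coefficient by n. *)
Lemma conv_deriv u v n :
  n * conv u v n = conv (fun i => i * u i) v n + conv u (fun i => i * v i) n.
Proof.
rewrite /conv big_distrr -big_split /=; apply: eq_bigr => i _.
by rewrite -{1}(subnKC (leq_ord i)) mulnDl !mulnA [u i * _]mulnC.
Qed.

Lemma convDl u u' v n : conv (fun i => u i + u' i) v n = conv u v n + conv u' v n.
Proof. by rewrite -big_split; apply: eq_bigr => i _; rewrite mulnDl. Qed.

End Convolution.

Lemma sum_dvdn k N (G : nat -> nat) : 0 < k ->
  \sum_(i < N.+1 | k %| i) G i = \sum_(j < (N %/ k).+1) G (k * j).
Proof.
move=> k_gt0; rewrite -(big_mkord (fun i => k %| i) G).
rewrite -(big_mkord xpredT (fun j => G (k * j))).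
elim: N => [|N IHN].
  by rewrite big_mkcond div0n !big_nat1 dvdn0 muln0.
rewrite big_mkcond big_nat_recr //= -big_mkcond IHN divnS //=.
case: ifPn => [dvd_k|] /=; last by rewrite addn0.
rewrite add1n [RHS]big_nat_recr //= [k * _]mulnC; congr (_ + G _).
have := divnK dvd_k; rewrite divnS // dvd_k add1n => ->.
by [].
Qed.

(** * Euler products *)

(** The substitution of q^k for q in the generating function of [g]. *)
Definition stretch k (g : nat -> nat) n := if k %| n then g (n %/ k) else 0.

Lemma conv_stretch k g g' n : 0 < k ->
  conv (stretch k g) (stretch k g') n = stretch k (conv g g') n.
Proof.
move=> k_gt0; rewrite /conv /stretch.
transitivity (\sum_(i < n.+1 | k %| i)
   g (i %/ k) * (if k %| n - i then g' ((n - i) %/ k) else 0)).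
  by rewrite [RHS]big_mkcond; apply: eq_bigr => i _; case: ifP.
rewrite (sum_dvdn _ (fun i => g (i %/ k) *
  (if k %| n - i then g' ((n - i) %/ k) else 0))) //.
have le_kj (j : 'I_(n %/ k).+1) : k * j <= n.
  by rewrite mulnC (leq_trans (leq_mul (leq_ord j) (leqnn k))) // leq_divM.
case: ifPn => [dvd_k | ndvd_k]; last first.
  by rewrite big1 // => j _; rewrite dvdn_subl ?dvdn_mulr // (negPf ndvd_k) muln0.
apply: eq_bigr => j _; rewrite dvdn_subl ?dvdn_mulr // dvd_k mulKn //.
by rewrite divnBr ?dvdn_mulr // mulKn.
Qed.

Section EulerProduct.
Variables (e w : nat -> nat) (c : nat).

(** Coefficient of q^n in E(q) E(q^2) ... E(q^m), where E is the generating function of [e]. *)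
Fixpoint euler_product m n :=
  if m is m'.+1 then conv (stretch m e) (euler_product m') n else (n == 0 : nat).

Definition divisor_part k n := stretch k (fun l => k * w l) n.

Definition divisor_sum m n := \sum_(1 <= k < m.+1) divisor_part k n.

Hypotheses (e0 : e 0 = 1) (w0 : w 0 = 0) (w1 : 0 < w 1) (wc : forall l, w l <= c).
(** In generating functions q E' = W E: [w] is the logarithmic derivative of one factor. That of
    E(q^k) is then k W(q^k), whose coefficients are [divisor_part k]. *)
Hypothesis ew : forall l, l * e l = conv w e l.

Lemma stretch_deriv k n : 0 < k ->
  n * stretch k e n = conv (divisor_part k) (stretch k e) n.
Proof.
move=> k_gt0; rewrite conv_stretch // /stretch.
case: ifP => [dvd_k|_]; last by rewrite muln0.
rewrite -{1}(divnK dvd_k) mulnAC ew /conv big_distrl /=.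
by apply: eq_bigr => i _; rewrite mulnC mulnA.
Qed.

Lemma euler_product_deriv m n :
  n * euler_product m n = conv (divisor_sum m) (euler_product m) n.
Proof.
elim: m n => [|m IHm] n.
  rewrite /conv big1 => [|i _]; first by case: n => //= n; rewrite muln0.
  by rewrite /divisor_sum big_geq.
rewrite [LHS]conv_deriv.
have -> : conv (fun i => i * stretch m.+1 e i) (euler_product m) n =
    conv (divisor_part m.+1) (euler_product m.+1) n.
  rewrite (convA _ (stretch m.+1 e) (euler_product m)).
  by apply: eq_conv => // i _; apply: stretch_deriv.
have -> : conv (stretch m.+1 e) (fun i => i * euler_product m i) n =
    conv (divisor_sum m) (euler_product m.+1) n.
  transitivity (conv (stretch m.+1 e) (conv (divisor_sum m) (euler_product m)) n).
    exact: eq_conv.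
  rewrite convA (convA _ (stretch m.+1 e) (euler_product m)).
  by apply: eq_conv => // i _; apply: convC.
rewrite -convDl; apply: eq_conv => // i _.
by rewrite /divisor_sum [RHS]big_nat_recr //= addnC.
Qed.

Lemma divisor_part0 k n : n < k -> divisor_part k n = 0.
Proof.
rewrite /divisor_part /stretch; case: n => [|n] ltnk.
  by rewrite dvdn0 div0n w0 muln0.
by case: ifP => // /(dvdn_leq (ltn0Sn n)); rewrite leqNgt ltnk.
Qed.

Lemma divisor_sum_stable m n : n <= m -> divisor_sum m n = divisor_sum n n.
Proof.
move=> lenm; rewrite /divisor_sum (big_cat_nat _ (n := n.+1)) //=.
rewrite [X in _ + X]big_nat_cond [X in _ + X]big1 ?addn0 // => k.
by rewrite andbT => /andP[ltnk _]; apply: divisor_part0.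
Qed.

(** For k > n the factor E(q^k) is 1 + O(q^(n+1)), so the diagonal value is the coefficient of the
    infinite product. *)
Lemma euler_product_stable m n : n <= m -> euler_product m n = euler_product n n.
Proof.
move=> lenm; rewrite -(subnKC lenm); elim: (m - n) => [|d IHd]; first by rewrite addn0.
rewrite addnS /= -IHd /conv big_ord_recl big1 => [|i _].
  by rewrite subn0 addn0 /stretch dvdn0 div0n e0 mul1n.
rewrite /= /stretch /bump /= add1n; case: ifP => // /(dvdn_leq (ltn0Sn _)).
by rewrite leqNgt ltnS (leq_trans (ltn_ord i)) ?leq_addr.
Qed.

Lemma euler_product_recurrence n :
  n.+1 * euler_product n.+1 n.+1 =
  \sum_(k < n.+1) divisor_sum k.+1 k.+1 * euler_product (n - k) (n - k).
Proof.
rewrite euler_product_deriv /conv big_ord_recl.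
rewrite [X in X * _]big1_seq => [|k /andP[_]]; last first.
  by rewrite mem_index_iota => /andP[k_gt0 _]; apply: divisor_part0.
rewrite mul0n add0n; apply: eq_bigr => k _.
rewrite lift0 subSS (divisor_sum_stable (ltn_ord k)).
by rewrite (euler_product_stable (n := n - k)) // leqW // leq_subr.
Qed.

Lemma divisor_sum_ge n : n <= divisor_sum n n.
Proof.
case: n => // n; rewrite /divisor_sum big_nat_recr //=.
rewrite (leq_trans _ (leq_addl _ _)) //.
by rewrite /divisor_part /stretch dvdnn divnn leq_pmulr.
Qed.

(** Exchanging the sums, each k contributes k w(i) for 1 <= i <= N/k, hence at most c N in total,
    and there are N values of k. *)
Lemma divisor_sum_sum_le N :
  \sum_(j < N.+1) divisor_sum j j <= c * N.+1 ^ 2.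
Proof.
rewrite (eq_bigr (fun j : 'I_N.+1 => divisor_sum N j)) => [|j _]; last first.
  by rewrite (divisor_sum_stable (leq_ord j)).
rewrite exchange_big /= big_nat_cond.
apply: (@leq_trans (\sum_(1 <= k < N.+1 | (1 <= k < N.+1) && true) c * N.+1)); last first.
  rewrite -big_nat_cond big_const_nat iter_addn_0 subn1 /= -mulnA leq_mul2l.
  by rewrite leq_mul2l leqnSn !orbT.
apply: leq_sum => k; rewrite andbT => /andP[k_gt0 _].
rewrite /divisor_part /stretch -big_mkcond.
rewrite (sum_dvdn N (fun j => k * w (j %/ k))) // big_ord_recl muln0 div0n w0 muln0 add0n.
apply: (@leq_trans (\sum_(i < N %/ k) k * c)).
  by apply: leq_sum => i _; rewrite leq_mul2l mulKn // wc orbT.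
rewrite sum_nat_const card_ord mulnA [X in _ <= X]mulnC leq_mul2r.
by rewrite (leq_trans (leq_divM _ _)) ?orbT.
Qed.

End EulerProduct.

(** The case E = 1/(1-q), with q E'/E = q/(1-q). *)
Lemma conv_ones l : l * 1 = conv (fun i => (0 < i : nat)) (fun=> 1) l.
Proof.
rewrite /conv big_ord_recl /= muln1 add0n.
by rewrite (eq_bigr (fun=> 1)) // sum1_card card_ord.
Qed.

(** The case E = (1+q)/(1-q) = 1 + 2q + 2q^2 + ..., with q E'/E = 2q/(1-q^2). *)
Lemma conv_odd l : l * (l > 0).+1 =
  conv (fun i => 2 * odd i) (fun i => (i > 0).+1) l.
Proof.
have half n : \sum_(i < n) odd i = n./2.
  by elim: n => [|n IHn]; rewrite ?big_ord0 // big_ord_recr IHn /= addnC uphalf_half.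
rewrite /conv big_ord_recr /= subnn muln1.
rewrite (eq_bigr (fun i : 'I_l => 4 * odd i)) => [|i _]; last first.
  by rewrite subn_gt0 ltn_ord mulnAC.
rewrite -big_distrr /= half; case: l => // l.
by rewrite -[4]/(2 * 2) -mulnA -mulnDr [2 * _./2]mul2n addnC odd_double_half mulnC.
Qed.

(** * Enumeration by blocks of equal parts *)

Lemma uniq_flatten_map (I T : eqType) (g : I -> seq T) (key : T -> I) (r : seq I) :
  uniq r -> (forall i, i \in r -> uniq (g i)) ->
  (forall i x, i \in r -> x \in g i -> key x = i) ->
  uniq (flatten [seq g i | i <- r]).
Proof.
elim: r => //= i r IHr /andP[i_notin uniq_r] uniq_g key_g.
rewrite cat_uniq uniq_g ?mem_head //= IHr // => [|j r_j|j x r_j]; first 1 last.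
- by rewrite uniq_g // inE r_j orbT.
- by move=> gx; rewrite (key_g j) // inE r_j orbT.
rewrite andbT; apply/hasPn => x /flatten_mapP[j r_j gj_x]; apply/negP => gi_x.
by move: i_notin; rewrite -(key_g i x) ?mem_head // (key_g j x) ?r_j // inE r_j orbT.
Qed.

(** Reduces the cardinals defining [p] and [pbar] to the length of an explicit list: the last
    hypothesis lifts every sequence satisfying [P] to a bounded sequence over the finite type. *)
Lemma card_bseq_enum (U : finType) (T : eqType) (v : U -> T) n
    (P : pred (seq T)) (r : seq (seq T)) : injective v -> uniq r ->
  (forall s, (s \in r) = P s) ->
  (forall s, P s -> size s <= n /\ {in s, forall x, exists u, v u = x}) ->
  #|[set s : n.-bseq U | P [seq v k | k <- s]]| = size r.
Proof.
move=> inj_v uniq_r mem_r bound_P; set A := [set s : _ | _].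
rewrite cardE -(size_map (fun s : n.-bseq U => [seq v k | k <- s])).
apply/perm_size/uniq_perm => // [|s].
  rewrite map_inj_uniq ?enum_uniq // => s t /(inj_map inj_v); exact: val_inj.
rewrite mem_r; apply/mapP/idP => [[t]|Ps]; first by rewrite mem_enum inE => Pt ->.
have [le_size onto] := bound_P s Ps.
have [t def_s] : exists t, s = [seq v k | k <- t].
  elim: s onto {Ps le_size} => [|x s IHs] onto; first by exists [::].
  have [|t ->] := IHs; first by move=> y s_y; apply: onto; rewrite inE s_y orbT.
  by have [u <-] := onto x (mem_head _ _); exists (u :: t).
have size_t : size t <= n by rewrite def_s size_map in le_size.
by exists (Bseq size_t); rewrite ?mem_enum ?inE -def_s.
Qed.

(* A block is the list of all the parts of one given size; [block k l] lists the
   admissible blocks of [l] parts of size [k]. *)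
Section Blocks.
Variables (T : eqType) (part : T -> nat) (block : nat -> nat -> seq (seq T)).
Variable e : nat -> nat.
Hypothesis size_block : forall k l, 0 < k -> size (block k l) = e l.
Hypothesis uniq_block : forall k l, uniq (block k l).
Hypothesis blockP : forall k l b, b \in block k l ->
  (size b == l) && all (fun x => part x == k) b.

Definition blocked m n (s : seq T) :=
  [&& sorted geq (map part s), all (fun x => 0 < part x <= m) s,
      sumn (map part s) == n &
      all (fun k => [seq x <- s | part x == k]
             \in block k (size [seq x <- s | part x == k])) (iota 1 m)].

(** Splits off the block of the [l] parts equal to [m], which come first in decreasing order; the
    recursion mirrors [euler_product], whose m-th factor counts these blocks. *)
Fixpoint blocked_enum m n : seq (seq T) :=
  if m is m'.+1 then
    flatten [seq flatten [seq [seq b ++ s | s <- blocked_enum m' (n - l * m)]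
                         | b <- block m l] | l <- iota 0 (n %/ m).+1]
  else if n is 0 then [:: [::]] else [::].

Lemma blocked_enumS m n : blocked_enum m.+1 n =
  flatten [seq flatten [seq [seq b ++ s | s <- blocked_enum m (n - l * m.+1)]
                       | b <- block m.+1 l] | l <- iota 0 (n %/ m.+1).+1].
Proof. by []. Qed.

Lemma size_blocked_enum m n : size (blocked_enum m n) = euler_product e m n.
Proof.
elim: m n => [|m IHm] n; first by case: n.
rewrite blocked_enumS size_flatten /shape -map_comp sumnE big_map /=.
rewrite /conv /stretch.
transitivity (\sum_(i < n.+1 | m.+1 %| i) e (i %/ m.+1) * euler_product e m (n - i)).
  rewrite (sum_dvdn _ (fun i => e (i %/ m.+1) * euler_product e m (n - i))) //.
  rewrite -(big_mkord xpredT (fun j => e (m.+1 * j %/ m.+1) *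
    euler_product e m (n - m.+1 * j))) /index_iota subn0.
  apply: eq_bigr => l _; rewrite size_flatten /shape -map_comp.
  rewrite (eq_map (g := fun=> euler_product e m (n - l * m.+1))) => [|b].
    rewrite sumnE big_map big_const_seq count_predT iter_addn_0 size_block //.
    by rewrite mulKn // mulnC [l * _]mulnC.
  by rewrite /= size_map IHm.
by rewrite [LHS]big_mkcond; apply: eq_bigr => i _; case: ifP.
Qed.

Lemma filter_blocked m (s : seq T) : sorted geq (map part s) ->
  all (fun x => 0 < part x <= m.+1) s ->
  s = [seq x <- s | part x == m.+1] ++ [seq x <- s | part x <= m].
Proof.
elim: s => //= x s IHs sorted_s /andP[/andP[x_gt0 le_x] le_s].
have [xm|] := eqVneq (part x) m.+1.
  by rewrite xm ltnn /= -IHs ?(path_sorted sorted_s).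
move=> neq_x; have le_xm : part x <= m by rewrite -ltnS ltn_neqAle neq_x.
have le_sm : all (fun y => part y <= m) s.
  have := order_path_min (rev_trans leq_trans) sorted_s.
  rewrite all_map; apply: sub_all => y /= le_yx; exact: leq_trans le_yx le_xm.
rewrite le_xm (eq_in_filter (a2 := pred0)) => [|y /(allP le_sm)/= le_y].
  by rewrite filter_pred0 /= (all_filterP le_sm).
by apply/negbTE; rewrite neq_ltn ltnS le_y.
Qed.

Lemma filter_cat_block m l b s : b \in block m.+1 l ->
  all (fun x => 0 < part x <= m) s ->
  [/\ [seq x <- b ++ s | part x == m.+1] = b, [seq x <- b ++ s | part x <= m] = s &
      forall k, k <= m -> [seq x <- b ++ s | part x == k] = [seq x <- s | part x == k]].
Proof.
move=> /blockP/andP[_ all_b] all_s; rewrite !filter_cat; split=> [||k lekm].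
- rewrite (all_filterP all_b) -[RHS]cats0; congr (_ ++ _).
  rewrite (eq_in_filter (a2 := pred0)) ?filter_pred0 // => x /(allP all_s)/andP[_ le_x].
  by apply/negbTE; rewrite neq_ltn ltnS le_x.
- rewrite (eq_in_filter (a2 := pred0)) => [|x /(allP all_b)/eqP->]; last by rewrite ltnn.
  rewrite filter_pred0; apply/all_filterP; apply: sub_all all_s => x /andP[] //.
- rewrite filter_cat (eq_in_filter (s := b) (a2 := pred0)) ?filter_pred0 //.
  by move=> x /(allP all_b)/eqP->; apply/negbTE; rewrite neq_ltn ltnS lekm orbT.
Qed.

Lemma sumn_part_const k (b : seq T) : all (fun x => part x == k) b ->
  sumn (map part b) = size b * k.
Proof. by elim: b => //= x b IHb /andP[/eqP-> /IHb->]; rewrite mulSn. Qed.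

Lemma mem_blocked_enum m n s : (s \in blocked_enum m n) = blocked m n s.
Proof.
elim: m n s => [|m IHm] n s.
  rewrite /blocked /= andbT; case: s => [|x s]; first by case: n.
  by rewrite /= ltnNge andNb !andbF; case: n.
rewrite blocked_enumS; apply/flatten_mapP/idP => [[l]|].
  rewrite mem_iota add0n ltnS => /andP[_ le_l] /flatten_mapP[b block_b].
  move=> /mapP[t]; rewrite IHm => /and4P[sorted_t all_t /eqP sum_t all_k] ->.
  have [Eb Et Ek] := filter_cat_block block_b all_t.
  have /andP[/eqP size_b all_b] := blockP block_b.
  apply/and4P; split.
  - have geq_trans : transitive geq by apply: rev_trans leq_trans.
    rewrite map_cat sorted_pairwise // pairwise_cat -!sorted_pairwise // sorted_t andbT.
    apply/andP; split.
      apply/allrelP => _ _ /mapP[x b_x ->] /mapP[y t_y ->] /=.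
      by rewrite (eqP (allP all_b x b_x)) leqW //; case/andP: (allP all_t y t_y).
    have /all_pred1P-> : all (pred1 m.+1) (map part b) by rewrite all_map.
    by elim: (size _) => // -[|i] //= ->; rewrite leqnn.
  - rewrite all_cat; apply/andP; split.
      by apply: sub_all all_b => x /eqP->; rewrite leqnn.
    by apply: sub_all all_t => x /andP[-> /leqW].
  - rewrite map_cat sumn_cat sum_t (sumn_part_const all_b) size_b subnKC //.
    by rewrite -leq_divRL.
  - have -> : iota 1 m.+1 = rcons (iota 1 m) m.+1.
      by rewrite -[X in iota 1 X]addn1 iotaD cats1 add1n.
    rewrite all_rcons Eb size_b block_b /=.
    apply/allP => k; rewrite mem_iota => /andP[k_gt0]; rewrite add1n ltnS => lekm.
    by rewrite Ek //; apply: (allP all_k); rewrite mem_iota k_gt0 add1n ltnS.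
case/and4P=> sorted_s all_s /eqP sum_s all_k.
have def_s := filter_blocked sorted_s all_s.
set b := [seq x <- s | part x == m.+1] in def_s *.
set t := [seq x <- s | part x <= m] in def_s *.
have all_b : all (fun x => part x == m.+1) b by apply: filter_all.
have sum_bt : size b * m.+1 + sumn (map part t) = n.
  by rewrite -sum_s [in RHS]def_s map_cat sumn_cat (sumn_part_const all_b).
have block_b : b \in block m.+1 (size b).
  by apply: (allP all_k); rewrite mem_iota add1n ltnS leqnn.
exists (size b).
  by rewrite mem_iota add0n ltnS leq_divRL // -sum_bt leq_addr.
apply/flatten_mapP; exists b => //; apply/mapP; exists t => //.
rewrite IHm; apply/and4P; split.
- by apply: (subseq_sorted _ _ sorted_s); [apply: rev_trans leq_trans | apply/map_subseq/filter_subseq].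
- by rewrite all_filter; apply: sub_all all_s => x /andP[x_gt0 _] /=; rewrite x_gt0 implybb.
- by rewrite -sum_bt addKn.
- apply/allP => k; rewrite mem_iota add1n ltnS => /andP[k_gt0 lekm].
  have -> : [seq x <- t | part x == k] = [seq x <- s | part x == k].
    rewrite -filter_predI; apply: eq_filter => x /=.
    by case: eqP => // ->; rewrite lekm.
  by apply: (allP all_k); rewrite mem_iota add1n ltnS k_gt0 leqW.
Qed.

Lemma uniq_blocked_enum m n : uniq (blocked_enum m n).
Proof.
elim: m n => [|m IHm] n; first by case: n.
have key l b s : b \in block m.+1 l -> s \in blocked_enum m (n - l * m.+1) ->
    [seq x <- b ++ s | part x == m.+1] = b.
  move=> block_b; rewrite mem_blocked_enum => /and4P[_ all_s _ _].
  by have [] := filter_cat_block block_b all_s.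
rewrite blocked_enumS.
(* The number of largest parts recovers [l]; below, the sublist of largest parts recovers the block
   [b]. *)
apply: (uniq_flatten_map (key := fun s => size [seq x <- s | part x == m.+1])).
- exact: iota_uniq.
- move=> l _; apply: (uniq_flatten_map (key := filter (fun x => part x == m.+1))) => //.
    by move=> b _; rewrite map_inj_uniq // => s t /eqP; rewrite eqseq_cat // eqxx => /eqP.
  by move=> b s block_b /mapP[t t_in ->]; apply: (key l).
- move=> l s _ /flatten_mapP[b block_b /mapP[t t_in ->]]; rewrite (key l) //.
  by have /andP[/eqP] := blockP block_b.
Qed.

End Blocks.

(** * Partitions and overpartitions *)

Definition plain_block k l : seq (seq nat) := [:: nseq l k].

(** Equal parts are either all plain or overlined at the first only: two blocks for l > 0 and one
    for l = 0, the coefficients of (1+q)/(1-q). *)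
Definition marked_block k l : seq (seq (nat * bool)) :=
  if l is l'.+1 then [:: (k, true) :: nseq l' (k, false); nseq l (k, false)]
  else [:: [::]].

Lemma plain_blockP k l b : b \in plain_block k l ->
  (size b == l) && all (fun x => id x == k) b.
Proof.
by rewrite inE => /eqP->; rewrite size_nseq eqxx /= (all_pred1_nseq k l).
Qed.

Lemma marked_blockE k c : all (fun x => x.1 == k) c ->
  (c \in marked_block k (size c)) = all (fun x => ~~ x.2) (behead c).
Proof.
case: c => //= -[k' b] c /andP[/eqP/= -> all_c].
have -> : all (fun x => ~~ x.2) c = (c == nseq (size c) (k, false)).
  elim: c all_c => //= -[i b'] c IHc /andP[/eqP/= -> /IHc->].
  by rewrite eqseq_cons xpair_eqE eqxx /=; case: b'.
rewrite !inE !eqseq_cons !xpair_eqE !eqxx /=.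
by case: b; rewrite ?orbF.
Qed.

Lemma marked_blockP k l b : b \in marked_block k l ->
  (size b == l) && all (fun x => x.1 == k) b.
Proof.
case: l => [|l]; first by rewrite inE => /eqP->.
have all_k : all (fun x : nat * bool => x.1 == k) (nseq l (k, false)).
  by rewrite all_nseq eqxx orbT.
by rewrite !inE => /orP[]/eqP->; rewrite /= size_nseq !eqxx.
Qed.

Lemma is_partition_parts n s : is_partition n s -> all (fun x => 0 < x <= n) s.
Proof.
move=> Ps; have [_ le_s] := is_partition_bounded Ps.
have /and3P[_ s_gt0 _] := Ps; apply/allP => x s_x.
by apply/andP; split; [apply: (allP s_gt0) | apply: (allP le_s)].
Qed.

Lemma is_partition_blocked n s : is_partition n s = blocked id plain_block n n s.
Proof.
apply/idP/and4P => [Ps | [sorted_s all_s sum_s _]]; last first.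
  rewrite map_id in sorted_s sum_s; apply/and3P; split=> //.
  by apply: sub_all all_s => x /andP[].
have all_s := is_partition_parts Ps.
have /and3P[sorted_s s_gt0 sum_s] := Ps; rewrite !map_id; split=> //.
apply/allP => k _; rewrite inE; apply/eqP/all_pred1P; exact: filter_all.
Qed.

Lemma p_euler_product n : p n = euler_product (fun=> 1) n n.
Proof.
rewrite -(size_blocked_enum (block := plain_block) (fun _ _ _ => erefl)).
apply: card_bseq_enum; first exact: val_inj.
- by apply: uniq_blocked_enum => // k l b; apply: plain_blockP.
- move=> s; rewrite is_partition_blocked; apply: mem_blocked_enum.
  by move=> k l b; apply: plain_blockP.
- move=> s Ps; have [le_size le_s] := is_partition_bounded Ps; split=> // x s_x.
  by exists (Ordinal (allP le_s x s_x)).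
Qed.

Definition first_marked (s : seq (nat * bool)) :=
  all (fun i => (nth (0, false) s i).2 ==>
                (index (nth 0 (unzip1 s) i) (unzip1 s) == i))
      (iota 0 (size s)).

Lemma first_marked_rcons s x : first_marked (rcons s x) =
  first_marked s && (x.2 ==> (x.1 \notin unzip1 s)).
Proof.
rewrite /first_marked size_rcons.
have -> : iota 0 (size s).+1 = rcons (iota 0 (size s)) (size s).
  by rewrite -addn1 iotaD cats1.
have size_u : size (unzip1 s) = size s by rewrite size_map.
rewrite all_rcons andbC; congr (_ && _).
  apply: eq_in_all => i; rewrite mem_iota add0n => /andP[_ lt_i].
  rewrite /unzip1 map_rcons !nth_rcons size_map lt_i -cats1 index_cat.
  by rewrite mem_nth // size_map.
rewrite /unzip1 map_rcons !nth_rcons size_map ltnn eqxx -cats1 index_cat size_map /= eqxx addn0.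
case: (boolP (x.1 \in _)) => [s_x|_]; last by rewrite eqxx.
by rewrite -/(unzip1 s) ltn_eqF // -size_u index_mem.
Qed.

(** Turns the positional condition on overlined parts into one condition per part size. The
    induction appends at the right because being a first occurrence depends only on the earlier
    entries. *)
Lemma first_markedE m s : all (fun x => 0 < x.1 <= m) s ->
  first_marked s =
  all (fun k => [seq x <- s | x.1 == k]
         \in marked_block k (size [seq x <- s | x.1 == k])) (iota 1 m).
Proof.
elim/last_ind: s => [_|s x IHs].
  by rewrite /first_marked /=; apply/esym/allP => k _; rewrite inE.
rewrite all_rcons => /andP[x_m /IHs IH]; rewrite first_marked_rcons IH.
have fE t k : ([seq y <- t | y.1 == k] \in
    marked_block k (size [seq y <- t | y.1 == k])) =
    all (fun y => ~~ y.2) (behead [seq y <- t | y.1 == k]).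
  by rewrite marked_blockE // filter_all.
have fR k : [seq y <- rcons s x | y.1 == k] =
    if x.1 == k then rcons [seq y <- s | y.1 == k] x else [seq y <- s | y.1 == k].
  by rewrite filter_rcons.
have x_in : x.1 \in iota 1 m by rewrite mem_iota add1n ltnS.
have memE : (x.1 \notin unzip1 s) = ([seq y <- s | y.1 == x.1] == [::]).
  rewrite -[_ == [::]]negbK -has_filter; congr (~~ _); apply/mapP/hasP.
    by case=> y s_y ->; exists y.
  by case=> y s_y /eqP <-; exists y.
apply/andP/allP => [[/allP all_k mark_x] k k_in | all_k].
  rewrite fE fR; case: eqP => [xk|_]; last by rewrite -fE all_k.
  have := all_k k k_in; rewrite fE; move: mark_x; rewrite memE xk.
  case: [seq y <- s | y.1 == k] => [|y t] //= /implyP mark_x all_t.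
  rewrite all_rcons all_t andbT; apply/negP => /mark_x //.
split.
  apply/allP => k k_in; have := all_k k k_in; rewrite !fE fR; case: eqP => // _.
  by case: [seq y <- s | y.1 == k] => [|y t] //=; rewrite all_rcons => /andP[].
have := all_k _ x_in; rewrite fE fR eqxx memE.
by case: [seq y <- s | y.1 == x.1] => [|y t] /=; rewrite ?implybT // all_rcons implybF => /andP[].
Qed.

Lemma is_overpartition_blocked n s :
  is_overpartition n s = blocked fst marked_block n n s.
Proof.
apply/andP/and4P => [[Ps mark_s] | [sorted_s all_s sum_s mark_s]].
  have := is_partition_parts Ps; rewrite all_map => all_s.
  have /and3P[sorted_s _ sum_s] := Ps; split=> //.
  by rewrite -first_markedE.
split; last by rewrite -/(first_marked s) (first_markedE all_s).
apply/and3P; split=> //; rewrite all_map; by apply: sub_all all_s => x /andP[].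
Qed.

Lemma pbar_euler_product n : pbar n = euler_product (fun l => (0 < l).+1) n n.
Proof.
rewrite -(size_blocked_enum (block := marked_block)); last by move=> k [].
have uniq_block k l : uniq (marked_block k l).
  by case: l => //= l; rewrite inE eqseq_cons xpair_eqE andbF.
apply: (card_bseq_enum (v := fun x : 'I_n.+1 * bool => (val x.1, x.2))).
- by move=> [i b] [j c] /= [/val_inj-> ->].
- by apply: uniq_blocked_enum => // k l b; apply: marked_blockP.
- move=> s; rewrite is_overpartition_blocked; apply: mem_blocked_enum.
  by move=> k l b; apply: marked_blockP.
- move=> s /andP[Ps _]; have [le_size le_s] := is_partition_bounded Ps.
  rewrite size_map in le_size; split=> // -[x b] s_x.
  have lt_x : x < n.+1 by apply: (allP le_s); apply: (map_f fst s_x).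
  by exists (Ordinal lt_x, b).
Qed.

End Partitions.
Import Partitions.

(** * Transfer to integer sequences and conclusion *)

Local Open Scope ring_scope.

Lemma euler_product_euler_recurrence (e w : nat -> nat) (c : nat) :
  e 0%N = 1%N -> w 0%N = 0%N -> (0 < w 1)%N -> (forall l, (w l <= c)%N) ->
  (forall l, (l * e l)%N = conv w e l) ->
  Analysis.euler_recurrence (fun n => Raxioms.INR (divisor_sum w n n))
    (fun n => Raxioms.INR (euler_product e n n)) (Raxioms.INR c).
Proof.
move=> e0 w0 w1 wc ew; split.
- by rewrite /divisor_sum big_geq.
- by move=> k; apply/RleP; rewrite !INRE ler_nat divisor_sum_ge.
- move=> n; apply/RleP; rewrite sum_f_R0E big_mkord RmultE RpowE RplusE R1E !INRE.
  rewrite natr1 -natrX -natrM.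
  under eq_bigr do rewrite INRE.
  by rewrite -natr_sum ler_nat divisor_sum_sum_le.
- by [].
- by move=> n; apply/RleP; rewrite INRE ler0n.
- move=> n; rewrite RmultE !INRE -natrM (euler_product_recurrence e0 w0 ew).
  rewrite sum_f_R0E big_mkord natr_sum.
  by apply: eq_bigr => k _; rewrite natrM RmultE !INRE.
Qed.

Lemma turan_of_euler_recurrence f K (b : nat -> nat) :
  Analysis.euler_recurrence f (fun n => Raxioms.INR (b n)) K ->
  forall r : nat, let a := diffn r (fun n => (b n)%:Z) in
  exists N : nat, forall n : nat, (N <= n)%N ->
    0 <= 4 * (a n ^+ 2 - a n.-1 * a n.+1) * (a n.+1 ^+ 2 - a n * a n.+2)
         - (a n * a n.+1 - a n.-1 * a n.+2) ^+ 2.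
Proof.
move=> rec_b r a; have [N turan_pos] := Analysis.turan_pdiff _ _ _ rec_b r.
have aE m : Nat.iter r Analysis.pdiff (fun n => Raxioms.INR (b n)) m = (a m)%:~R.
  rewrite /a; elim: r {a turan_pos} m => [|r IHr] m; first by rewrite /= INRE.
  by rewrite /= /Analysis.pdiff !IHr RminusE /diffn /= /diff rmorphB.
(* The real inequality concerns the window starting at n, the stated one the window starting at the
   predecessor; hence the threshold [N.+1]. *)
exists N.+1 => -[//|n]; rewrite ltnS => /ssrnat.leP/turan_pos/RltP.
rewrite /= /Analysis.turan_form !aE !(RminusE, RmultE, RpowE) IZRposE INRE => pos_n.
by apply: ltW; rewrite -(ltr0z Rdefinitions.R) !(rmorphB, rmorphM, rmorphXn).
Qed.

Theorem theorem1p11 (r : nat) (hr : (1 <= r)%N) (a : nat -> int)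
    (ha : a = diffn r (fun n => (p n)%:Z) \/
          a = diffn r (fun n => (pbar n)%:Z)) :
  exists N : nat, forall n : nat, (N <= n)%N ->
    0 <= 4 * (a n ^+ 2 - a n.-1 * a n.+1) * (a n.+1 ^+ 2 - a n * a n.+2)
         - (a n * a n.+1 - a n.-1 * a n.+2) ^+ 2.
Proof.
have diffn_ext (b c : nat -> int) : b =1 c -> diffn r b =1 diffn r c.
  by move=> eq_bc; elim: (r) => //= k IHk m; rewrite /diff !IHk.
case: ha => ->.
- have rec_p := @euler_product_euler_recurrence (fun=> 1%N) (fun l => (0 < l)%N) 1
    erefl erefl isT (fun l => leq_b1 _) conv_ones.
  have [N HN] := turan_of_euler_recurrence _ _ _ rec_p r.
  exists N => n /HN.
  by rewrite -!(diffn_ext _ _ (fun m => congr1 Posz (p_euler_product m))).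
- have le_2odd l : (2 * odd l <= 2)%N by case: odd.
  have rec_pbar := @euler_product_euler_recurrence (fun l => (0 < l)%N.+1)
    (fun l => 2 * odd l)%N 2 erefl erefl isT le_2odd conv_odd.
  have [N HN] := turan_of_euler_recurrence _ _ _ rec_pbar r.
  exists N => n /HN.
  by rewrite -!(diffn_ext _ _ (fun m => congr1 Posz (pbar_euler_product m))).
Qed.
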